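(* Let $K\in BC^1(\mathbf{R}^2)$ be real-valued and satisfy: (i) there is $k_m>0$ with $K(x)\ge k_m$ for all $x\in\mathbf{R}^2$; (ii) $x\cdot\nabla K(x)\le 0$ for all $x\in\mathbf{R}^2$; (iii) there are constants $r_0>0$ and $k_0\ge k_m$ with $K(x)=k_0$ for all $|x|>r_0$. Let $L>0$ and let $u_0,u_1\in C_0^\infty(\mathbf{R}^2)$ be real-valued with $\operatorname{supp}u_j\subset B_L:=\{x\in\mathbf{R}^2:|x|\le L\}$ ($j=0,1$). Let $u(t,x)$ be the unique smooth solution of $$u_{tt}-\nabla\cdot(K(x)\nabla u)=0\ \ \text{in }(0,\infty)\times\mathbf{R}^2,\qquad u(0,x)=u_0(x),\ u_t(0,x)=u_1(x).$$ Let $R>r_0$ be arbitrary and fixed. Then $$E_{u,R}(t):=\frac12\int_{|x|\le R}\big(|u_t(t,x)|^2+K(x)|\nabla u(t,x)|^2\big)\,dx=O\big(t^{-1}\sqrt{\log t}\big)\quad (t\to\infty),$$ i.e. there exist $C>0$ and $T>1$ with $E_{u,R}(t)\le C\,t^{-1}\sqrt{\log t}$ for all $t\ge T$.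
   Context: $BC^1(\mathbf{R}^2)$ denotes the bounded continuous functions on $\mathbf{R}^2$ whose first partial derivatives exist and are bounded continuous. All functions are real-valued. *)

(* Defs.v *)
From Stdlib Require Import Reals List.
From Coquelicot Require Import Coquelicot.
Open Scope R_scope.

Definition norm2 (x1 x2 : R) : R := sqrt (x1 ^ 2 + x2 ^ 2).

Definition cont2 (f : R -> R -> R) : Prop :=
  forall x y : R, continuous (fun p : R * R => f (fst p) (snd p)) (x, y).
Definition cont3 (f : R -> R -> R -> R) : Prop :=
  forall t x y : R,
    continuous (fun p : R * (R * R) => f (fst p) (fst (snd p)) (snd (snd p))) (t, (x, y)).

Definition bounded2 (f : R -> R -> R) : Prop :=
  exists M : R, forall x y : R, Rabs (f x y) <= M.

Definition pd1 (f : R -> R -> R) (x y : R) : R := Derive (fun s => f s y) x.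
Definition pd2 (f : R -> R -> R) (x y : R) : R := Derive (fun s => f x s) y.

Definition has_partials2 (f : R -> R -> R) : Prop :=
  forall x y : R, ex_derive (fun s => f s y) x /\ ex_derive (fun s => f x s) y.

Fixpoint iterD (l : list bool) (f : R -> R -> R) : R -> R -> R :=
  match l with
  | nil => f
  | b :: l' => if b then pd1 (iterD l' f) else pd2 (iterD l' f)
  end.

Definition smooth2 (f : R -> R -> R) : Prop :=
  forall l : list bool, cont2 (iterD l f) /\ has_partials2 (iterD l f).

Definition BC1 (K : R -> R -> R) : Prop :=
  cont2 K /\ bounded2 K /\ has_partials2 K /\
  cont2 (pd1 K) /\ cont2 (pd2 K) /\ bounded2 (pd1 K) /\ bounded2 (pd2 K).

Definition supp_in_ball (f : R -> R -> R) (L : R) : Prop :=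
  forall x y : R, norm2 x y > L -> f x y = 0.

Definition dt (u : R -> R -> R -> R) (t x y : R) : R := Derive (fun s => u s x y) t.
Definition dx1 (u : R -> R -> R -> R) (t x y : R) : R := Derive (fun s => u t s y) x.
Definition dx2 (u : R -> R -> R -> R) (t x y : R) : R := Derive (fun s => u t x s) y.

Definition C1_3 (u : R -> R -> R -> R) : Prop :=
  cont3 u /\
  (forall t x y : R, ex_derive (fun s => u s x y) t /\
                     ex_derive (fun s => u t s y) x /\
                     ex_derive (fun s => u t x s) y) /\
  cont3 (dt u) /\ cont3 (dx1 u) /\ cont3 (dx2 u).

Definition box_int (F : R -> R -> R -> R) (a b M : R) : R :=
  RInt (fun t => RInt (fun x => RInt (fun y => F t x y) (- M) M) (- M) M) a b.

(* u is a (weak, C^1) solution of u_tt - div (K grad u) = 0 in (0,oo) x R^2: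
   for every C^1 test function phi supported in a compact box
   [a,b] x [-M,M]^2 with 0 < a,
   int (- u_t phi_t + K grad u . grad phi) = 0. *)
Definition weak_wave_sol (K : R -> R -> R) (u : R -> R -> R -> R) : Prop :=
  forall (phi : R -> R -> R -> R) (a b M : R),
    0 < a -> a < b -> 0 < M -> C1_3 phi ->
    (forall t x y : R, (t <= a \/ b <= t \/ M <= Rabs x \/ M <= Rabs y) -> phi t x y = 0) ->
    box_int (fun t x y =>
               - (dt u t x y * dt phi t x y)
               + K x y * (dx1 u t x y * dx1 phi t x y + dx2 u t x y * dx2 phi t x y))
            a b M = 0.

Definition local_energy (K : R -> R -> R) (u : R -> R -> R -> R) (R0 t : R) : R :=
  / 2 * RInt (fun x =>
          RInt (fun y => (dt u t x y) ^ 2 + K x y * ((dx1 u t x y) ^ 2 + (dx2 u t x y) ^ 2))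
               (- sqrt (R0 ^ 2 - x ^ 2)) (sqrt (R0 ^ 2 - x ^ 2)))
        (- R0) R0.

(* Main.v *)
(* For a classical solution, the multipliers t u_t + x.grad u + u/2 and x.grad K <= 0
   give t E + int u_t x.grad u + (1/2) int u u_t <= const.  Since K = k0 = c^2 for
   |x| > r0 and u(t) is supported in |x| <= rho + c t, the second term is bounded by
   (t + const) E outside a ball and by const E inside it, so that
   t E_R <= const + (1/2) |int u u_t| <= const (1 + |u|_2).  The energy identity for
   w = int_0^t u, which solves w_tt - div (K grad w) = u_1, bounds |u|_2^2 by data
   and int u_1 w; integrating by parts against x/(1+|x|^2), whose L2 norm on a ball
   of radius O(t) is O(sqrt(log t)), gives |u|_2 = O(sqrt(log t)).

   A C^1 weak solution has no second derivatives, so the multipliers u_t and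
   x.grad u are replaced by symmetric difference quotients along time translations
   and dilations; these are C^1 test functions, and in the weak equation the
   differences fall, by a change of variables, on the cutoff and on K only. *)
Require Import Defs.
From Stdlib Require Import Reals.
From Coquelicot Require Import Coquelicot.
From Stdlib Require Import Lra Psatz Classical ClassicalEpsilon.
Open Scope R_scope.

(** * Continuity of parameter-dependent integrals *)

(** In the two Noether arguments no limit of a difference quotient is ever estimated. By Hadamard's
    formula the quotient is an integral of the derivative over the unit interval; this integral
    still makes sense at parameter 0 and is continuous there, so an identity valid for small
    positive parameters extends to 0 by continuity. Hence the emphasis on integrals depending
    continuously on a parameter, and on integrands continuous on the whole space: integrability and
    exchange of integrals then reduce to the syntax of the integrand. The plane enters through the
    L2 norm of the solution: the Hardy inequality fails there, and the field x/(1+|x|^2) just misses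
    being square integrable. This is the source of the logarithm. *)

Definition Cont {P Q : UniformSpace} (f : P -> Q) : Prop :=
  forall p, continuous f p.

Section Continuity.
Context {P : UniformSpace}.

Lemma Cont_const {Q : UniformSpace} (c : Q) : Cont (fun _ : P => c).
Proof. intro p; apply continuous_const. Qed.

Lemma Cont_id : Cont (fun p : P => p).
Proof. intro p; apply continuous_id. Qed.

Lemma Cont_comp {Q S : UniformSpace} (f : P -> Q) (g : Q -> S) :
  Cont f -> Cont g -> Cont (fun p => g (f p)).
Proof. intros Hf Hg p; apply (continuous_comp f g); auto. Qed.

Lemma Cont_fst {Q S : UniformSpace} (f : P -> Q * S) :
  Cont f -> Cont (fun p => fst (f p)).
Proof. intros Hf; apply (Cont_comp f fst Hf); intro; apply continuous_fst. Qed.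

Lemma Cont_snd {Q S : UniformSpace} (f : P -> Q * S) :
  Cont f -> Cont (fun p => snd (f p)).
Proof. intros Hf; apply (Cont_comp f snd Hf); intro; apply continuous_snd. Qed.

Lemma Cont_pair {Q S : UniformSpace} (f : P -> Q) (g : P -> S) :
  Cont f -> Cont g -> Cont (fun p => (f p, g p)).
Proof.
intros Hf Hg p.
apply (continuous_comp_2 f g (fun a b => (a, b)) p (Hf p) (Hg p)).
apply (continuous_ext (fun x => x)); [intros [a b]; reflexivity | apply continuous_id].
Qed.

Lemma Cont_plus (f g : P -> R) : Cont f -> Cont g -> Cont (fun p => f p + g p).
Proof. intros Hf Hg p; apply (continuous_plus (V := R_NormedModule) f g); auto. Qed.

Lemma Cont_opp (f : P -> R) : Cont f -> Cont (fun p => - f p).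
Proof. intros Hf p; apply (continuous_opp (V := R_NormedModule) f); auto. Qed.

Lemma Cont_minus (f g : P -> R) : Cont f -> Cont g -> Cont (fun p => f p - g p).
Proof. intros Hf Hg p; apply (continuous_minus (V := R_NormedModule) f g); auto. Qed.

Lemma Cont_mult (f g : P -> R) : Cont f -> Cont g -> Cont (fun p => f p * g p).
Proof. intros Hf Hg p; apply (continuous_mult (K := R_AbsRing) f g); auto. Qed.

Lemma Cont_pow (f : P -> R) n : Cont f -> Cont (fun p => f p ^ n).
Proof.
intros Hf; induction n; [exact (Cont_const 1) | exact (Cont_mult f (fun p => f p ^ n) Hf IHn)].
Qed.

Lemma Cont_inv (f : P -> R) : Cont f -> (forall p, f p <> 0) -> Cont (fun p => / f p).
Proof.
intros Hf H0 p; apply (continuous_comp f Rinv); auto.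
now apply continuous_Rinv.
Qed.

Lemma Cont_sqrt (f : P -> R) : Cont f -> Cont (fun p => sqrt (f p)).
Proof. intros Hf; apply (Cont_comp f sqrt Hf); intro; apply continuous_sqrt. Qed.

Lemma Cont_exp (f : P -> R) : Cont f -> Cont (fun p => exp (f p)).
Proof. intros Hf; apply (Cont_comp f exp Hf); intro; apply continuous_exp. Qed.

Lemma Cont_Rabs (f : P -> R) : Cont f -> Cont (fun p => Rabs (f p)).
Proof. intros Hf; apply (Cont_comp f Rabs Hf); intro; apply continuous_Rabs. Qed.

Lemma Cont_ext {Q : UniformSpace} (f g : P -> Q) :
  (forall p, f p = g p) -> Cont f -> Cont g.
Proof. intros H Hf p; apply (continuous_ext f); auto. Qed.

Lemma Cont_Rmax (f g : P -> R) : Cont f -> Cont g -> Cont (fun p => Rmax (f p) (g p)).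
Proof.
intros Hf Hg.
apply Cont_ext with (fun p => (f p + g p + Rabs (f p - g p)) * / 2).
- intro p; unfold Rmax, Rabs; destruct (Rle_dec _ _), (Rcase_abs _); lra.
- apply Cont_mult; [|apply Cont_const].
  apply Cont_plus; [now apply Cont_plus|].
  apply Cont_Rabs; now apply Cont_minus.
Qed.

Lemma Cont_Rmin (f g : P -> R) : Cont f -> Cont g -> Cont (fun p => Rmin (f p) (g p)).
Proof.
intros Hf Hg.
apply Cont_ext with (fun p => - Rmax (- f p) (- g p)).
- intro p; now rewrite Ropp_Rmax, !Ropp_involutive.
- now apply Cont_opp, Cont_Rmax; apply Cont_opp.
Qed.

Lemma Cont_cont2 f (a b : P -> R) :
  cont2 f -> Cont a -> Cont b -> Cont (fun p => f (a p) (b p)).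
Proof.
intros Hf Ha Hb.
apply (Cont_comp (fun p => (a p, b p)) (fun q => f (fst q) (snd q))).
- now apply Cont_pair.
- intros [x y]; apply Hf.
Qed.

Lemma Cont_cont3 f (a b c : P -> R) :
  cont3 f -> Cont a -> Cont b -> Cont c -> Cont (fun p => f (a p) (b p) (c p)).
Proof.
intros Hf Ha Hb Hc.
apply (Cont_comp (fun p => (a p, (b p, c p)))
         (fun q => f (fst q) (fst (snd q)) (snd (snd q)))).
- apply Cont_pair; [|apply Cont_pair]; trivial.
- intros [x [y z]]; apply Hf.
Qed.

End Continuity.

Lemma ex_RInt_Cont (f : R -> R) a b : Cont f -> ex_RInt f a b.
Proof. intro Hf; apply (ex_RInt_continuous (V := R_CompleteNormedModule)); intros; apply Hf. Qed.

Lemma Cont_slice {P S : UniformSpace} (f : P -> S -> R) p :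
  Cont (fun q : P * S => f (fst q) (snd q)) -> Cont (f p).
Proof.
intros Hf.
exact (Cont_comp (fun y => (p, y)) (fun q : P * S => f (fst q) (snd q))
         (Cont_pair _ _ (Cont_const p) Cont_id) Hf).
Qed.

(** Moves variable bounds into the integrand, so that continuity in a parameter has to be proved on
    a fixed interval only. *)
Lemma RInt_unit_interval (f : R -> R) a b :
  Cont f -> RInt f a b = RInt (fun s => (b - a) * f ((b - a) * s + a)) 0 1.
Proof.
intro Hf.
generalize (RInt_comp_lin f (b - a) a 0 1).
intro H; etransitivity; [|symmetry; etransitivity; [|apply H]].
- f_equal; ring.
- reflexivity.
- now apply ex_RInt_Cont.
Qed.

(* Compactness of [0,1] makes continuity in the parameter uniform in the
   integration variable. *)
Lemma Cont_RInt_unit {P : UniformSpace} (f : P -> R -> R) :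
  Cont (fun q : P * R => f (fst q) (snd q)) -> Cont (fun p => RInt (f p) 0 1).
Proof.
intros Hf p0; apply filterlim_locally; intro eps.
assert (He : 0 < eps / 4) by (destruct eps; simpl; lra).
set (e' := mkposreal _ He).
assert (Hd : forall y : R, exists d : posreal, forall p y',
   ball p0 d p -> Rabs (y' - y) < d -> Rabs (f p y' - f p0 y) < e').
{ intro y; generalize (Hf (p0, y)); intro H.
  generalize (proj1 (filterlim_locally _ _) H e'); intros [d H'].
  exists d; intros p y' Hp Hy; apply (H' (p, y')); now split. }
set (delta := fun y => proj1_sig (constructive_indefinite_description _ (Hd y))).
assert (Hdelta : forall y p y',
   ball p0 (delta y) p -> Rabs (y' - y) < delta y -> Rabs (f p y' - f p0 y) < e')
  by (intro y; apply (proj2_sig (constructive_indefinite_description _ (Hd y)))).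
destruct (compactness_value_1d 0 1 delta) as [d Hc].
exists d; intros p Hp.
assert (Hex : forall q, ex_RInt (f q) 0 1)
  by (intro q; apply ex_RInt_Cont; now apply Cont_slice).
change (Rabs (RInt (f p) 0 1 - RInt (f p0) 0 1) < eps).
rewrite <- (RInt_minus (V := R_CompleteNormedModule)); auto.
apply Rle_lt_trans with ((1 - 0) * (eps / 2)).
2: destruct eps; simpl; lra.
apply abs_RInt_le_const; [lra | apply (ex_RInt_minus (V := R_NormedModule)); auto|].
intros y Hy.
(* The compactness lemma provides the centre [t] only under a double negation. *)
destruct (NNPP _ (Hc y Hy)) as [t [_ [Hyt Hdt]]].
assert (H1 : Rabs (f p y - f p0 t) < e').
{ apply Hdelta; trivial; apply ball_le with d; trivial. }
assert (H2 : Rabs (f p0 y - f p0 t) < e').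
{ apply Hdelta; trivial; apply ball_center. }
change (Rabs (f p y - f p0 y) <= eps / 2).
unfold e' in *; simpl in H1, H2.
apply Rabs_def2 in H1; apply Rabs_def2 in H2; apply Rabs_le; lra.
Qed.

Lemma Cont_RInt {P : UniformSpace} (f : P -> R -> R) (a b : P -> R) :
  Cont (fun q : P * R => f (fst q) (snd q)) -> Cont a -> Cont b ->
  Cont (fun p => RInt (f p) (a p) (b p)).
Proof.
intros Hf Ha Hb.
apply Cont_ext with
  (fun p => RInt (fun s => (b p - a p) * f p ((b p - a p) * s + a p)) 0 1).
- intro p; symmetry; apply RInt_unit_interval; now apply Cont_slice.
- apply (Cont_RInt_unit (fun p s => (b p - a p) * f p ((b p - a p) * s + a p))).
  assert (Hba : forall c : P -> R, Cont c -> Cont (fun q : P * R => c (fst q)))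
    by (intros c Hc; exact (Cont_comp _ c (Cont_fst _ Cont_id) Hc)).
  assert (HD : Cont (fun q : P * R => b (fst q) - a (fst q)))
    by (apply Cont_minus; now apply Hba).
  apply (Cont_mult _ (fun q => f (fst q) ((b (fst q) - a (fst q)) * snd q + a (fst q))));
    [exact HD|].
  apply (Cont_comp (fun q : P * R => (fst q, (b (fst q) - a (fst q)) * snd q + a (fst q)))
     (fun q => f (fst q) (snd q))); [|exact Hf].
  apply Cont_pair; [apply (Cont_fst _ Cont_id)|].
  apply Cont_plus; [|now apply Hba].
  apply Cont_mult; [exact HD | apply (Cont_snd _ Cont_id)].
Qed.

Lemma cont2_Cont f : Cont (fun q : R * R => f (fst q) (snd q)) -> cont2 f.
Proof. intros H x y; apply H. Qed.

Lemma cont3_Cont f :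
  Cont (fun q : R * (R * R) => f (fst q) (fst (snd q)) (snd (snd q))) -> cont3 f.
Proof. intros H x y z; apply H. Qed.

(** Follows the syntax of the integrand; it leaves open the nonvanishing of denominators and the
    atoms whose continuity is not among the hypotheses. *)
Ltac cont :=
  lazymatch goal with
  | |- cont2 _ => apply cont2_Cont; cbv beta; cont
  | |- cont3 _ => apply cont3_Cont; cbv beta; cont
  | |- Cont (fun _ => ?c) => apply (Cont_const c)
  | |- Cont (fun p => p) => apply Cont_id
  | |- Cont (fun p => fst (@?f p)) => apply (Cont_fst f); cont
  | |- Cont (fun p => snd (@?f p)) => apply (Cont_snd f); cont
  | |- Cont (fun p => @?f p + @?g p) => apply (Cont_plus f g); cont
  | |- Cont (fun p => @?f p - @?g p) => apply (Cont_minus f g); cont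
  | |- Cont (fun p => @?f p * @?g p) => apply (Cont_mult f g); cont
  | |- Cont (fun p => @?f p / @?g p) =>
      apply (Cont_mult f (fun p => / g p)); cont
  | |- Cont (fun p => - @?f p) => apply (Cont_opp f); cont
  | |- Cont (fun p => / @?f p) => apply (Cont_inv f); [cont | cbv beta]
  | |- Cont (fun p => (@?f p) ^ ?n) => apply (Cont_pow f n); cont
  | |- Cont (fun p => sqrt (@?f p)) => apply (Cont_sqrt f); cont
  | |- Cont (fun p => exp (@?f p)) => apply (Cont_exp f); cont
  | |- Cont (fun p => Rabs (@?f p)) => apply (Cont_Rabs f); cont
  | |- Cont (fun p => Rmax (@?f p) (@?g p)) => apply (Cont_Rmax f g); cont
  | |- Cont (fun p => Rmin (@?f p) (@?g p)) => apply (Cont_Rmin f g); cont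
  | |- Cont (fun p => RInt (@?f p) (@?a p) (@?b p)) =>
      apply (Cont_RInt f a b); [cbv beta; cont | cont | cont]
  | |- Cont _ =>
    match goal with
    | H : cont3 ?f |- Cont (fun p => ?f (@?a p) (@?b p) (@?c p)) =>
        apply (Cont_cont3 f a b c H); cont
    | H : cont2 ?f |- Cont (fun p => ?f (@?a p) (@?b p)) =>
        apply (Cont_cont2 f a b H); cont
    | H : Cont ?f |- Cont (fun p => ?f (@?a p)) =>
        apply (Cont_comp a f); [cont | exact H]
    | H : Cont ?f |- Cont ?f => exact H
    | _ => idtac
    end
  | |- _ => idtac
  end.

(** * Iterated integrals *)

Lemma cont2_slice1 f y : cont2 f -> Cont (fun x => f x y).
Proof. intro H; cont. Qed.

Lemma cont2_slice2 f x : cont2 f -> Cont (f x).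
Proof. intro H; apply (Cont_cont2 f (fun _ => x) (fun y => y) H); cont. Qed.

Lemma cont3_slice f t : cont3 f -> cont2 (f t).
Proof. intro H; cont. Qed.

Ltac as_R := match goal with |- @eq _ ?a ?b => change (@eq R a b) end.

Lemma RInt_ext_R (f g : R -> R) a b :
  (forall x, Rmin a b < x < Rmax a b -> f x = g x) -> RInt f a b = RInt g a b.
Proof. apply (RInt_ext (V := R_CompleteNormedModule)). Qed.

Lemma RInt_is_derive (f g : R -> R) a b :
  (forall s, is_derive f s (g s)) -> Cont g -> RInt g a b = f b - f a.
Proof.
intros Hf Hg; apply is_RInt_unique.
apply (is_RInt_derive (V := R_CompleteNormedModule) f g); intros; [apply Hf | apply Hg].
Qed.

(** Hadamard's formula: the factor after [b - a] is the difference quotient, continuously extended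
    to [b = a]. *)
Lemma increment_integral (f g : R -> R) a b :
  (forall s, is_derive f s (g s)) -> Cont g ->
  f b - f a = (b - a) * RInt (fun s => g ((b - a) * s + a)) 0 1.
Proof.
intros Hf Hg.
rewrite <- (RInt_is_derive f g a b Hf Hg), RInt_unit_interval by trivial.
apply (RInt_scal (V := R_CompleteNormedModule)
         (fun s => g ((b - a) * s + a))); apply ex_RInt_Cont; cont.
Qed.

Lemma is_derive_RInt_upper (f : R -> R) a x :
  Cont f -> is_derive (fun x => RInt f a x) x (f x).
Proof.
intro Hf; apply (is_derive_RInt (V := R_NormedModule) f _ a); [|apply Hf].
apply filter_forall; intro b.
apply (RInt_correct (V := R_CompleteNormedModule)); now apply ex_RInt_Cont.
Qed.

Lemma RInt_plus_Cont (f g : R -> R) a b :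
  Cont f -> Cont g -> RInt (fun x => f x + g x) a b = RInt f a b + RInt g a b.
Proof. intros Hf Hg; apply (RInt_plus (V := R_CompleteNormedModule)); now apply ex_RInt_Cont. Qed.

Lemma RInt_scal_Cont (f : R -> R) c a b :
  Cont f -> RInt (fun x => c * f x) a b = c * RInt f a b.
Proof. intros Hf; apply (RInt_scal (V := R_CompleteNormedModule)); now apply ex_RInt_Cont. Qed.

Lemma RInt_Chasles_Cont (f : R -> R) a b c :
  Cont f -> RInt f a b + RInt f b c = RInt f a c.
Proof. intros Hf; apply (RInt_Chasles (V := R_CompleteNormedModule)); now apply ex_RInt_Cont. Qed.

Lemma RInt_le_Cont (f g : R -> R) a b :
  a <= b -> Cont f -> Cont g -> (forall x, a < x < b -> f x <= g x) ->
  RInt f a b <= RInt g a b.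
Proof. intros; apply RInt_le; trivial; now apply ex_RInt_Cont. Qed.

Lemma RInt_ge_0_Cont (f : R -> R) a b :
  a <= b -> Cont f -> (forall x, a < x < b -> 0 <= f x) -> 0 <= RInt f a b.
Proof. intros; apply RInt_ge_0; trivial; now apply ex_RInt_Cont. Qed.

Lemma RInt_zero (f : R -> R) a b :
  (forall x, Rmin a b < x < Rmax a b -> f x = 0) -> RInt f a b = 0.
Proof.
intros H; rewrite (RInt_ext_R f (fun _ => 0)) by trivial.
rewrite (RInt_const (V := R_CompleteNormedModule)); apply Rmult_0_r.
Qed.

Lemma RInt_shift (f : R -> R) a b h :
  Cont f -> RInt (fun x => f (x + h)) a b = RInt f (a + h) (b + h).
Proof.
intro Hf.
generalize (RInt_comp_lin (V := R_CompleteNormedModule) f 1 h a b).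
rewrite !Rmult_1_l; intro H; rewrite <- H by now apply ex_RInt_Cont.
apply RInt_ext_R; intros x _; symmetry; etransitivity; [apply Rmult_1_l | now rewrite Rmult_1_l].
Qed.

(** The integrals from [a] to [y] and from [y] to [b] are nonnegative with nonpositive sum, so the
    primitive is zero inside the interval; its derivative is [f]. *)
Lemma RInt_nonneg_zero (f : R -> R) a b :
  Cont f -> (forall x, a < x < b -> 0 <= f x) -> RInt f a b <= 0 ->
  forall x, a < x < b -> f x = 0.
Proof.
intros Hf Hpos Hle x Hx.
assert (HF : forall y, a < y < b -> RInt f a y = 0).
{ intros y Hy.
  assert (0 <= RInt f a y) by (apply RInt_ge_0_Cont; trivial; [lra | intros; apply Hpos; lra]).
  assert (0 <= RInt f y b) by (apply RInt_ge_0_Cont; trivial; [lra | intros; apply Hpos; lra]).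
  generalize (RInt_Chasles_Cont f a y b Hf); lra. }
generalize (is_derive_unique _ _ _ (is_derive_RInt_upper f a x Hf)); intro H.
rewrite <- H, (Derive_ext_loc _ (fun _ => 0)); [apply Derive_const|].
assert (Hd : 0 < Rmin (x - a) (b - x)) by (apply Rmin_glb_lt; lra).
exists (mkposreal _ Hd); intros y Hy; apply HF.
change (Rabs (y - x) < Rmin (x - a) (b - x)) in Hy.
apply Rabs_def2 in Hy.
generalize (Rmin_l (x - a) (b - x)) (Rmin_r (x - a) (b - x)); lra.
Qed.

(** The only passage to the limit in the sequel: small step sizes tending to 0, and positive times
    tending to the initial time. *)
Lemma eq_at_right (f g : R -> R) p d :
  0 < d -> Cont f -> Cont g -> (forall s, p < s < p + d -> f s = g s) -> f p = g p.
Proof.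
intros Hd Hf Hg H.
apply NNPP; intro Hne.
assert (He : 0 < Rabs (f p - g p)) by (apply Rabs_pos_lt; lra).
assert (Hh : Cont (fun s => f s - g s)) by cont.
generalize (proj1 (filterlim_locally _ _) (Hh p) (mkposreal _ He)); intros [e He'].
set (s := p + Rmin d e / 2).
assert (Hs : 0 < Rmin d e) by (apply Rmin_glb_lt; [lra | apply cond_pos]).
generalize (Rmin_l d e) (Rmin_r d e); intros H1 H2.
assert (Hb : ball p e s).
{ change (Rabs (s - p) < e); unfold s; rewrite Rabs_pos_eq; lra. }
generalize (He' s Hb); change (Rabs ((f s - g s) - (f p - g p)) < Rabs (f p - g p) -> False).
rewrite (H s) by (unfold s; lra).
replace (g s - g s - (f p - g p)) with (- (f p - g p)) by ring.
rewrite Rabs_Ropp; lra.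
Qed.

Lemma is_derive_RInt_Cont (f g : R -> R -> R) a b :
  (forall s y, is_derive (fun s => f s y) s (g s y)) -> cont2 f -> cont2 g ->
  forall s, is_derive (fun s => RInt (f s) a b) s (RInt (g s) a b).
Proof.
intros Hfg Hf Hg s.
rewrite (RInt_ext_R (g s) (fun t => Derive (fun u => f u t) s)).
2: intros; symmetry; apply is_derive_unique, Hfg.
apply (is_derive_RInt_param f a b s).
- apply filter_forall; intros; eexists; apply Hfg.
- intros t _; apply continuity_2d_pt_filterlim.
  apply (filterlim_ext (fun z => g (fst z) (snd z))).
  { intro; symmetry; apply is_derive_unique, Hfg. }
  replace (Derive _ s) with (g s t) by (symmetry; apply is_derive_unique, Hfg).
  apply Hg.
- apply filter_forall; intro; apply ex_RInt_Cont, cont2_slice2, Hf.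
Qed.

(** As functions of the upper bound [b], both sides have the same derivative and vanish at
    [b = a]. *)
Lemma Fubini (f : R -> R -> R) a b c d :
  cont2 f ->
  RInt (fun x => RInt (fun y => f x y) c d) a b =
  RInt (fun y => RInt (fun x => f x y) a b) c d.
Proof.
intro Hf.
rewrite (RInt_is_derive (fun x => RInt (fun y => RInt (fun s => f s y) a x) c d)).
- rewrite (RInt_zero (fun y => RInt (fun s => f s y) a a) c d); [apply Rminus_0_r|].
  intros; apply (RInt_point (V := R_CompleteNormedModule)).
- apply (is_derive_RInt_Cont (fun x y => RInt (fun s => f s y) a x) (fun x y => f x y)).
  + intros x y; apply (is_derive_RInt_upper (fun s => f s y)); now apply cont2_slice1.
  + cont.
  + exact Hf.
- cont.
Qed.

(** The chain rule rests on total differentiability, which follows from both partial derivatives and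
    the continuity of one of them. *)
Lemma is_derive_comp2 (f fx fy : R -> R -> R) (a b : R -> R) s a' b' :
  (forall x y, is_derive (fun x => f x y) x (fx x y)) ->
  (forall x y, is_derive (fun y => f x y) y (fy x y)) ->
  cont2 fx -> is_derive a s a' -> is_derive b s b' ->
  is_derive (fun s => f (a s) (b s)) s (fx (a s) (b s) * a' + fy (a s) (b s) * b').
Proof.
intros Hx Hy Hc Ha Hb; apply is_derive_Reals.
apply derivable_pt_lim_comp_2d; try (apply is_derive_Reals; trivial).
apply filterdiff_differentiable_pt_lim.
generalize (is_derive_filterdiff f (a s) (b s) fx (fy (a s) (b s))); intro H.
apply H; trivial.
apply filter_forall; intros; apply Hx.
Qed.

(** Compactly supported functions are integrated over a large centred square instead of the plane:
    each coordinate is then a one-variable matter, and dilations map squares to squares. *)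
Definition I2 (M : R) (f : R -> R -> R) : R :=
  RInt (fun x => RInt (fun y => f x y) (- M) M) (- M) M.

Lemma I2_ext M f g :
  0 <= M -> (forall x y, - M < x < M -> - M < y < M -> f x y = g x y) -> I2 M f = I2 M g.
Proof.
intros HM H; unfold I2.
apply RInt_ext_R; intros x; rewrite Rmin_left, Rmax_right by lra; intro Hx.
apply RInt_ext_R; intros y; rewrite Rmin_left, Rmax_right by lra; intro Hy; auto.
Qed.

Lemma I2_plus M f g :
  cont2 f -> cont2 g -> I2 M (fun x y => f x y + g x y) = I2 M f + I2 M g.
Proof.
intros Hf Hg; unfold I2.
rewrite <- RInt_plus_Cont by cont.
apply RInt_ext_R; intros x _; apply RInt_plus_Cont; cont.
Qed.

Lemma I2_scal M c f : cont2 f -> I2 M (fun x y => c * f x y) = c * I2 M f.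
Proof.
intros Hf; unfold I2.
rewrite <- RInt_scal_Cont by cont.
apply RInt_ext_R; intros x _; apply RInt_scal_Cont; cont.
Qed.

Lemma I2_le M f g :
  0 <= M -> cont2 f -> cont2 g ->
  (forall x y, - M < x < M -> - M < y < M -> f x y <= g x y) -> I2 M f <= I2 M g.
Proof.
intros HM Hf Hg H; unfold I2.
apply RInt_le_Cont; [lra | cont | cont |]; intros x Hx.
apply RInt_le_Cont; [lra | cont | cont |]; auto.
Qed.

Lemma I2_zero M f :
  0 <= M -> (forall x y, - M < x < M -> - M < y < M -> f x y = 0) -> I2 M f = 0.
Proof.
intros HM H; apply RInt_zero; intros x; rewrite Rmin_left, Rmax_right by lra; intro Hx.
apply RInt_zero; intros y; rewrite Rmin_left, Rmax_right by lra; intro Hy; auto.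
Qed.

Lemma I2_ge_0 M f :
  0 <= M -> cont2 f ->
  (forall x y, - M < x < M -> - M < y < M -> 0 <= f x y) -> 0 <= I2 M f.
Proof.
intros HM Hf H; rewrite <- (I2_zero M (fun _ _ => 0)) by trivial.
apply I2_le; trivial; cont.
Qed.

Lemma I2_nonneg_zero M f :
  cont2 f -> (forall x y, 0 <= f x y) -> I2 M f <= 0 ->
  forall x y, - M < x < M -> - M < y < M -> f x y = 0.
Proof.
intros Hf Hpos Hle x y Hx Hy.
apply (RInt_nonneg_zero (f x) (- M) M); auto; [now apply cont2_slice2|].
rewrite (RInt_nonneg_zero (fun x => RInt (f x) (- M) M) (- M) M); auto.
- lra.
- cont.
- intros z _; apply RInt_ge_0_Cont; [lra | now apply cont2_slice2 | auto].
Qed.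

Lemma RInt_enlarge (f : R -> R) m M :
  0 <= m <= M -> Cont f -> (forall x, m <= Rabs x -> f x = 0) ->
  RInt f (- M) M = RInt f (- m) m.
Proof.
intros Hm Hf H.
rewrite <- (RInt_Chasles_Cont f (- M) (- m) M), <- (RInt_Chasles_Cont f (- m) m M) by trivial.
rewrite (RInt_zero f (- M) (- m)), (RInt_zero f m M); [as_R; ring | | ].
all: intros x; rewrite Rmin_left, Rmax_right by lra; intro Hx; apply H.
- rewrite Rabs_pos_eq; lra.
- rewrite Rabs_left; lra.
Qed.

(** Compares squares of different sizes: after a dilation, and when the square grows with time while
    the initial data stay fixed. *)
Lemma I2_enlarge m M f :
  0 <= m <= M -> cont2 f -> (forall x y, m <= Rabs x \/ m <= Rabs y -> f x y = 0) ->
  I2 M f = I2 m f.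
Proof.
intros Hm Hf H; unfold I2.
rewrite (RInt_enlarge _ m M Hm); [ | cont | ].
- apply RInt_ext_R; intros x _; apply RInt_enlarge; auto; now apply cont2_slice2.
- intros x Hx; apply RInt_zero; auto.
Qed.

Lemma RInt_dilate (f : R -> R) l M :
  Cont f -> l * RInt (fun x => f (l * x)) (- M) M = RInt f (- (l * M)) (l * M).
Proof.
intro Hf.
generalize (RInt_comp_lin (V := R_CompleteNormedModule) f l 0 (- M) M).
intro H; rewrite <- RInt_scal_Cont by cont.
replace (- (l * M)) with (l * - M + 0) by ring.
replace (RInt f (l * - M + 0) (l * M)) with (RInt f (l * - M + 0) (l * M + 0))
  by (f_equal; ring).
rewrite <- H by now apply ex_RInt_Cont.
apply RInt_ext_R; intros x _; rewrite Rplus_0_r; reflexivity.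
Qed.

Lemma I2_dilate l M f :
  cont2 f -> l ^ 2 * I2 M (fun x y => f (l * x) (l * y)) = I2 (l * M) f.
Proof.
intro Hf; unfold I2.
rewrite <- (RInt_dilate (fun x => RInt (fun y => f x y) (- (l * M)) (l * M))) by cont.
replace (l ^ 2) with (l * l) by ring; rewrite Rmult_assoc; f_equal.
rewrite <- RInt_scal_Cont by cont.
apply RInt_ext_R; intros x _.
rewrite <- (RInt_dilate (fun y => f (l * x) y)); trivial; cont.
Qed.

Lemma I2_dx M f fx :
  cont2 f -> cont2 fx -> (forall x y, is_derive (fun x => f x y) x (fx x y)) ->
  (forall x y, M <= Rabs x -> f x y = 0) -> 0 <= M -> I2 M fx = 0.
Proof.
intros Hf Hfx H H0 HM; unfold I2.
rewrite (RInt_is_derive (fun x => RInt (fun y => f x y) (- M) M)).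
- rewrite !RInt_zero; [as_R; ring | |]; intros; apply H0.
  + rewrite Rabs_left1; lra.
  + rewrite Rabs_pos_eq; lra.
- apply (is_derive_RInt_Cont (fun x y => f x y) (fun x y => fx x y)); auto.
- cont.
Qed.

Lemma I2_dy M f fy :
  cont2 f -> cont2 fy -> (forall x y, is_derive (fun y => f x y) y (fy x y)) ->
  (forall x y, M <= Rabs y -> f x y = 0) -> 0 <= M -> I2 M fy = 0.
Proof.
intros Hf Hfy H H0 HM; unfold I2.
apply RInt_zero; intros x _.
rewrite (RInt_is_derive (fun y => f x y)); auto.
- rewrite !H0; [as_R; ring | |].
  + rewrite Rabs_left1; lra.
  + rewrite Rabs_pos_eq; lra.
- cont.
Qed.

Lemma is_derive_I2 M (f g : R -> R -> R -> R) :
  cont3 f -> cont3 g -> (forall t x y, is_derive (fun t => f t x y) t (g t x y)) ->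
  forall t, is_derive (fun t => I2 M (f t)) t (I2 M (g t)).
Proof.
intros Hf Hg H t.
apply (is_derive_RInt_Cont (fun t x => RInt (fun y => f t x y) (- M) M)
        (fun t x => RInt (fun y => g t x y) (- M) M)); [|cont|cont].
intros s x.
apply (is_derive_RInt_Cont (fun t y => f t x y) (fun t y => g t x y)); trivial; cont.
Qed.

Lemma I2_RInt M (f : R -> R -> R -> R) a b :
  cont3 f -> RInt (fun t => I2 M (f t)) a b = I2 M (fun x y => RInt (fun t => f t x y) a b).
Proof.
intro Hf; unfold I2.
rewrite (Fubini (fun t x => RInt (fun y => f t x y) (- M) M)) by cont.
apply RInt_ext_R; intros x _.
apply (Fubini (fun t y => f t x y)); cont.
Qed.

(** * Weak conservation laws *)

(** The derivatives are arguments rather than [Derive] terms, so that test functions built by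
    products, compositions, shifts and dilations carry explicit derivatives. *)
Record is_C1 (u ut ux uy : R -> R -> R -> R) : Prop := {
  C1_cont : cont3 u;
  C1_cont_t : cont3 ut;
  C1_cont_x : cont3 ux;
  C1_cont_y : cont3 uy;
  C1_t : forall t x y, is_derive (fun s => u s x y) t (ut t x y);
  C1_x : forall t x y, is_derive (fun s => u t s y) x (ux t x y);
  C1_y : forall t x y, is_derive (fun s => u t x s) y (uy t x y) }.

Arguments C1_cont {u ut ux uy}.
Arguments C1_cont_t {u ut ux uy}.
Arguments C1_cont_x {u ut ux uy}.
Arguments C1_cont_y {u ut ux uy}.
Arguments C1_t {u ut ux uy}.
Arguments C1_x {u ut ux uy}.
Arguments C1_y {u ut ux uy}.

Lemma C1_3_is_C1 u : C1_3 u -> is_C1 u (dt u) (dx1 u) (dx2 u).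
Proof.
intros [H [Hd [Ht [Hx Hy]]]]; split; [exact H | exact Ht | exact Hx | exact Hy | | |];
  intros t x y; destruct (Hd t x y) as [Dt [Dx Dy]].
- exact (Derive_correct _ _ Dt).
- exact (Derive_correct _ _ Dx).
- exact (Derive_correct _ _ Dy).
Qed.

Lemma cont3_ext f g : (forall t x y, f t x y = g t x y) -> cont3 f -> cont3 g.
Proof. intros H Hf t x y; apply (continuous_ext _ _ _ (fun q => H _ _ _) (Hf t x y)). Qed.

Lemma is_C1_dt u ut ux uy t x y : is_C1 u ut ux uy -> dt u t x y = ut t x y.
Proof. intros H; apply is_derive_unique, (C1_t H). Qed.

Lemma is_C1_dx1 u ut ux uy t x y : is_C1 u ut ux uy -> dx1 u t x y = ux t x y.
Proof. intros H; apply is_derive_unique, (C1_x H). Qed.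

Lemma is_C1_dx2 u ut ux uy t x y : is_C1 u ut ux uy -> dx2 u t x y = uy t x y.
Proof. intros H; apply is_derive_unique, (C1_y H). Qed.

Lemma is_C1_C1_3 u ut ux uy : is_C1 u ut ux uy -> C1_3 u.
Proof.
intros H; split; [exact (C1_cont H)|split; [|split; [|split]]].
- intros t x y; split; [|split]; eexists;
    [exact (C1_t H t x y) | exact (C1_x H t x y) | exact (C1_y H t x y)].
- apply (cont3_ext ut); [|exact (C1_cont_t H)]; intros; symmetry; exact (is_C1_dt _ _ _ _ _ _ _ H).
- apply (cont3_ext ux); [|exact (C1_cont_x H)]; intros; symmetry; exact (is_C1_dx1 _ _ _ _ _ _ _ H).
- apply (cont3_ext uy); [|exact (C1_cont_y H)]; intros; symmetry; exact (is_C1_dx2 _ _ _ _ _ _ _ H).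
Qed.

Lemma is_derive_mult_R (f g : R -> R) x f' g' :
  is_derive f x f' -> is_derive g x g' ->
  is_derive (fun s => f s * g s) x (f' * g x + f x * g').
Proof. intros Hf Hg; apply (is_derive_mult f g x f' g' Hf Hg); intros; apply Rmult_comm. Qed.

Lemma is_derive_plus_R (f g : R -> R) x f' g' :
  is_derive f x f' -> is_derive g x g' -> is_derive (fun s => f s + g s) x (f' + g').
Proof. apply (is_derive_plus (V := R_NormedModule)). Qed.

Lemma is_derive_minus_R (f g : R -> R) x f' g' :
  is_derive f x f' -> is_derive g x g' -> is_derive (fun s => f s - g s) x (f' - g').
Proof. apply (is_derive_minus (V := R_NormedModule)). Qed.

Lemma is_derive_comp_R (f g : R -> R) x f' g' :
  is_derive f (g x) f' -> is_derive g x g' -> is_derive (fun s => f (g s)) x (f' * g').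
Proof.
intros Hf Hg; replace (f' * g') with (scal g' f') by apply Rmult_comm.
now apply (is_derive_comp (V := R_NormedModule)).
Qed.

Lemma is_derive_const_R (c x : R) : is_derive (fun _ : R => c) x 0.
Proof. apply (is_derive_const (V := R_NormedModule)). Qed.

Ltac c1 H := generalize (C1_cont H) (C1_cont_t H)
  (C1_cont_x H) (C1_cont_y H); intros.

Section C1_operations.
Variables u ut ux uy v vt vx vy : R -> R -> R -> R.
Hypothesis Hu : is_C1 u ut ux uy.
Hypothesis Hv : is_C1 v vt vx vy.

Lemma is_C1_mult :
  is_C1 (fun t x y => u t x y * v t x y)
    (fun t x y => ut t x y * v t x y + u t x y * vt t x y)
    (fun t x y => ux t x y * v t x y + u t x y * vx t x y)
    (fun t x y => uy t x y * v t x y + u t x y * vy t x y).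
Proof.
c1 Hu; c1 Hv.
split; try cont; intros.
- apply (is_derive_mult_R (fun s => u s x y) (fun s => v s x y));
    [apply (C1_t Hu) | apply (C1_t Hv)].
- apply (is_derive_mult_R (fun s => u t s y) (fun s => v t s y));
    [apply (C1_x Hu) | apply (C1_x Hv)].
- apply (is_derive_mult_R (fun s => u t x s) (fun s => v t x s));
    [apply (C1_y Hu) | apply (C1_y Hv)].
Qed.

Lemma is_C1_minus :
  is_C1 (fun t x y => u t x y - v t x y) (fun t x y => ut t x y - vt t x y)
    (fun t x y => ux t x y - vx t x y) (fun t x y => uy t x y - vy t x y).
Proof.
c1 Hu; c1 Hv.
split; try cont; intros.
- apply (is_derive_minus_R (fun s => u s x y) (fun s => v s x y));
    [apply (C1_t Hu) | apply (C1_t Hv)].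
- apply (is_derive_minus_R (fun s => u t s y) (fun s => v t s y));
    [apply (C1_x Hu) | apply (C1_x Hv)].
- apply (is_derive_minus_R (fun s => u t x s) (fun s => v t x s));
    [apply (C1_y Hu) | apply (C1_y Hv)].
Qed.

Lemma is_C1_comp (g g' : R -> R) :
  (forall s, is_derive g s (g' s)) -> Cont g' ->
  is_C1 (fun t x y => g (u t x y)) (fun t x y => g' (u t x y) * ut t x y)
    (fun t x y => g' (u t x y) * ux t x y) (fun t x y => g' (u t x y) * uy t x y).
Proof.
intros Hg Hg'; c1 Hu.
assert (Cont g) by (intro s; apply (ex_derive_continuous (V := R_NormedModule)); eexists; apply Hg).
split; try cont; intros.
- apply (is_derive_comp_R g (fun s => u s x y)); [apply Hg | apply (C1_t Hu)].
- apply (is_derive_comp_R g (fun s => u t s y)); [apply Hg | apply (C1_x Hu)].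
- apply (is_derive_comp_R g (fun s => u t x s)); [apply Hg | apply (C1_y Hu)].
Qed.

Lemma is_C1_shift h :
  is_C1 (fun t x y => u (t + h) x y) (fun t x y => ut (t + h) x y)
    (fun t x y => ux (t + h) x y) (fun t x y => uy (t + h) x y).
Proof.
c1 Hu; split; try cont; intros; [|apply (C1_x Hu) | apply (C1_y Hu)].
replace (ut (t + h) x y) with (ut (t + h) x y * 1) by ring.
apply (is_derive_comp_R (fun s => u s x y) (fun s => s + h)); [apply (C1_t Hu)|].
auto_derive; trivial.
Qed.

Lemma is_C1_dilate l :
  is_C1 (fun t x y => u t (l * x) (l * y)) (fun t x y => ut t (l * x) (l * y))
    (fun t x y => ux t (l * x) (l * y) * l) (fun t x y => uy t (l * x) (l * y) * l).
Proof.
c1 Hu; split; try cont; intros; [apply (C1_t Hu)| |].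
- apply (is_derive_comp_R (fun s => u t s (l * y)) (fun s => l * s)); [apply (C1_x Hu)|].
  auto_derive; trivial; ring.
- apply (is_derive_comp_R (fun s => u t (l * x) s) (fun s => l * s)); [apply (C1_y Hu)|].
  auto_derive; trivial; ring.
Qed.

(** The profile of [u] at one time, kept constant in time, is the test function behind the energy
    identity for the time integral of [u]. *)
Lemma is_C1_freeze tau :
  is_C1 (fun _ x y => u tau x y) (fun _ _ _ => 0)
    (fun _ x y => ux tau x y) (fun _ x y => uy tau x y).
Proof.
c1 Hu; split; try cont; intros;
  [apply is_derive_const_R | apply (C1_x Hu) | apply (C1_y Hu)].
Qed.

End C1_operations.

Lemma is_C1_time (th th' : R -> R) :
  (forall t, is_derive th t (th' t)) -> Cont th' ->
  is_C1 (fun t _ _ => th t) (fun t _ _ => th' t) (fun _ _ _ => 0) (fun _ _ _ => 0).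
Proof.
intros H H'.
assert (Cont th) by (intro s; apply (ex_derive_continuous (V := R_NormedModule)); eexists; apply H).
split; try cont; intros; auto; apply is_derive_const_R.
Qed.

(* Test with theta' = beta (g - c), where g = A - int B, beta is a bump and c is
   the beta-mean of g: then 0 = int theta' g = int beta (g - c)^2. *)
Lemma du_bois_reymond (A B : R -> R) p q :
  p < q -> Cont A -> Cont B ->
  (forall th th' : R -> R, (forall t, is_derive th t (th' t)) -> Cont th' ->
     (forall t, t <= p \/ q <= t -> th t = 0) ->
     RInt (fun t => th' t * A t + th t * B t) p q = 0) ->
  A q - A p = RInt B p q.
Proof.
intros Hpq HA HB H.
set (g := fun t => A t - RInt B p t).
assert (Hg : Cont g) by (unfold g; cont).
set (beta := fun t => Rmax 0 ((t - p) * (q - t))).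
assert (Hbeta : Cont beta) by (unfold beta; cont).
assert (Hb0 : forall t, t <= p \/ q <= t -> beta t = 0).
{ intros t Ht; unfold beta; apply Rmax_left; destruct Ht; nra. }
assert (Hbpos : forall t, p < t < q -> 0 < beta t).
{ intros t Ht; unfold beta; rewrite Rmax_right; nra. }
set (m := RInt beta p q).
assert (Hm : 0 < m) by (apply RInt_gt_0; auto).
set (c := RInt (fun t => beta t * g t) p q / m).
assert (Hth' : Cont (fun t => beta t * (g t - c))) by cont.
assert (Hmean : RInt (fun t => beta t * (g t - c)) p q = 0).
{ rewrite (RInt_ext_R _ (fun t => beta t * g t + (- c) * beta t)) by (intros; as_R; ring).
  rewrite RInt_plus_Cont, RInt_scal_Cont by cont.
  fold m; unfold c; as_R; field; lra. }
set (th := fun t => RInt (fun t => beta t * (g t - c)) p t).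
assert (Hth : forall t, is_derive th t (beta t * (g t - c)))
  by (intro t; apply (is_derive_RInt_upper _ p t Hth')).
assert (Hth0 : forall t, t <= p \/ q <= t -> th t = 0).
{ intros t [Ht|Ht]; unfold th.
  - apply RInt_zero; rewrite Rmin_right, Rmax_left by lra.
    intros x Hx; rewrite Hb0; [ring | lra].
  - rewrite <- (RInt_Chasles_Cont _ p q t), Hmean by trivial.
    rewrite RInt_zero; [as_R; ring|]; rewrite Rmin_left, Rmax_right by lra.
    intros x Hx; rewrite Hb0; [ring | lra]. }
assert (Hthc : Cont th) by (unfold th; cont).
(* Integration by parts trades [B] for its primitive; the boundary terms vanish with [th]. *)
assert (Hparts : RInt (fun t => beta t * (g t - c) * RInt B p t + th t * B t) p q = 0).
{ rewrite (RInt_is_derive (fun t => th t * RInt B p t)).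
  - rewrite !Hth0 by lra; as_R; ring.
  - intro s; apply (is_derive_mult_R th (fun t => RInt B p t)); trivial.
    now apply is_derive_RInt_upper.
  - cont. }
generalize (H th _ Hth Hth' Hth0); intro Htest.
assert (Hsq : RInt (fun t => beta t * (g t - c) ^ 2) p q = 0).
{ rewrite (RInt_ext_R _ (fun t =>
     ((beta t * (g t - c) * A t + th t * B t)
      + (-1) * (beta t * (g t - c) * RInt B p t + th t * B t))
     + (- c) * (beta t * (g t - c)))) by (intros; unfold g; as_R; ring).
  rewrite (RInt_plus_Cont (fun t => (beta t * (g t - c) * A t + th t * B t)
      + (-1) * (beta t * (g t - c) * RInt B p t + th t * B t))) by cont.
  rewrite (RInt_plus_Cont (fun t => beta t * (g t - c) * A t + th t * B t)) by cont.
  rewrite (RInt_scal_Cont (fun t => beta t * (g t - c))),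
    (RInt_scal_Cont (fun t => beta t * (g t - c) * RInt B p t + th t * B t)) by cont.
  rewrite Htest, Hparts, Hmean; as_R; ring. }
assert (Hgc : forall t, p < t < q -> g t = c).
{ intros t Ht.
  assert (H0 : beta t * (g t - c) ^ 2 = 0).
  { apply (RInt_nonneg_zero (fun t => beta t * (g t - c) ^ 2) p q); trivial; [cont| |lra].
    intros x Hx; apply Rmult_le_pos; [left; auto | apply pow2_ge_0]. }
  specialize (Hbpos t Ht).
  destruct (Rmult_integral _ _ H0) as [|H1]; [lra|].
  destruct (Req_dec (g t - c) 0); [lra|].
  now apply (pow_nonzero _ 2) in H2. }
assert (Hgp : g p = c).
{ apply (eq_at_right g (fun _ => c) p (q - p)); [lra | trivial | cont |].
  intros; apply Hgc; lra. }
(* The right endpoint is reached by reflection, since [eq_at_right] looks to the right only. *)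
assert (Hgq : g q = c).
{ replace q with (q - 0) by ring.
  apply (eq_at_right (fun s => g (q - s)) (fun _ => c) 0 (q - p)); [lra | cont | cont |].
  intros; apply Hgc; lra. }
generalize (eq_trans Hgq (eq_sym Hgp)); unfold g.
rewrite (RInt_point (V := R_CompleteNormedModule)).
change (@zero R_CompleteNormedModule) with 0; lra.
Qed.

(** Says weakly, for positive times, that the space-time divergence of the field (F0, F1, F2) is
    zero. The fluxes are general so that one integration lemma serves both the wave equation and the
    energy law derived from it. *)
Definition weak_law (F0 F1 F2 : R -> R -> R -> R) : Prop :=
  forall eta et ex ey a b M,
    is_C1 eta et ex ey -> 0 < a -> a < b -> 0 < M ->
    (forall t x y, t <= a \/ b <= t \/ M <= Rabs x \/ M <= Rabs y -> eta t x y = 0) ->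
    box_int (fun t x y => F0 t x y * et t x y + F1 t x y * ex t x y + F2 t x y * ey t x y)
      a b M = 0.

Lemma box_int_I2 F a b M : box_int F a b M = RInt (fun t => I2 M (F t)) a b.
Proof. reflexivity. Qed.

(** Test with [th t * z t x y]: the factor [th] supplies the compact support in time that [z] lacks,
    and the du Bois-Reymond lemma then removes it. *)
Lemma weak_law_integrated F0 F1 F2 z zt zx zy T M p q :
  cont3 F0 -> cont3 F1 -> cont3 F2 -> weak_law F0 F1 F2 ->
  is_C1 z zt zx zy -> 0 < M ->
  (forall t x y, 0 <= t <= T -> M <= Rabs x \/ M <= Rabs y -> z t x y = 0) ->
  0 <= p < q -> q <= T ->
  I2 M (fun x y => F0 q x y * z q x y) - I2 M (fun x y => F0 p x y * z p x y) =
  RInt (fun t => I2 M (fun x y =>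
     F0 t x y * zt t x y + F1 t x y * zx t x y + F2 t x y * zy t x y)) p q.
Proof.
intros H0 H1 H2 HW Hz HM Hsupp Hpq HqT.
c1 Hz.
set (A := fun t => I2 M (fun x y => F0 t x y * z t x y)).
set (B := fun t => I2 M (fun x y =>
     F0 t x y * zt t x y + F1 t x y * zx t x y + F2 t x y * zy t x y)).
assert (HA : Cont A) by (unfold A, I2; cont).
assert (HB : Cont B) by (unfold B, I2; cont).
assert (Hpos : forall p, 0 < p < q -> A q - A p = RInt B p q).
{ clear p Hpq; intros p Hpq; apply du_bois_reymond; trivial; [lra|].
  intros th th' Hth Hth' Hth0.
  assert (Hthc : Cont th) by (intro s;
    apply (ex_derive_continuous (V := R_NormedModule)); eexists; apply Hth).
  generalize (HW _ _ _ _ p q M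
    (is_C1_mult _ _ _ _ _ _ _ _ (is_C1_time th th' Hth Hth') Hz)).
  intro HW'; rewrite <- HW'; try lra.
  - rewrite box_int_I2; apply RInt_ext_R; intros t _; unfold A, B.
    rewrite <- !I2_scal, <- I2_plus by cont.
    apply I2_ext; [lra|]; intros; ring.
  - intros t x y Ht.
    destruct (Rle_or_lt t p); [rewrite Hth0 by lra; ring|].
    destruct (Rle_or_lt q t); [rewrite Hth0 by lra; ring|].
    rewrite Hsupp; [ring | lra |]; destruct Ht as [|[|]]; trivial; lra. }
change (A q - A p = RInt B p q).
(* The weak law tests positive times only; the initial time is reached by continuity in [p]. *)
destruct Hpq as [[Hp|<-] Hpq]; [now apply Hpos|].
apply (eq_at_right (fun p => A q - A p) (fun p => RInt B p q) 0 q); trivial; try cont.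
intros; apply Hpos; lra.
Qed.

(** * Local energy law *)

Lemma RInt_support (f : R -> R) a' a b b' :
  a' <= a <= b -> b <= b' -> Cont f -> (forall x, x < a \/ b < x -> f x = 0) ->
  RInt f a' b' = RInt f a b.
Proof.
intros Ha Hb Hf H.
rewrite <- (RInt_Chasles_Cont f a' a b'), <- (RInt_Chasles_Cont f a b b') by trivial.
rewrite (RInt_zero f a' a), (RInt_zero f b b'); [as_R; ring | |].
all: intros x; rewrite Rmin_left, Rmax_right by lra; intro; apply H; lra.
Qed.

Lemma is_derive_zero_loc (f : R -> R) x l e :
  0 < e -> is_derive f x l -> (forall y, x - e < y < x + e -> f y = 0) -> l = 0.
Proof.
intros He Hf H; rewrite <- (is_derive_unique _ _ _ Hf).
rewrite (Derive_ext_loc _ (fun _ => 0)); [apply Derive_const|].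
exists (mkposreal _ He); intros y Hy; apply H.
change (Rabs (y - x) < e) in Hy; apply Rabs_def2 in Hy; lra.
Qed.

Section EnergyLaw.
Variables (K : R -> R -> R) (u ut ux uy : R -> R -> R -> R).
Hypothesis HK : cont2 K.
Hypothesis Hu : is_C1 u ut ux uy.
Hypothesis Hweak : weak_law (fun t x y => - ut t x y)
  (fun t x y => K x y * ux t x y) (fun t x y => K x y * uy t x y).

(* Noether's argument for time translations: test with eta (u(t+h) - u(t-h)),
   divide by h and let h -> 0: this is the multiplier 2 eta u_t, without u_tt. *)
Lemma energy_law :
  weak_law (fun t x y => - (ut t x y ^ 2 + K x y * (ux t x y ^ 2 + uy t x y ^ 2)))
    (fun t x y => 2 * K x y * ut t x y * ux t x y)
    (fun t x y => 2 * K x y * ut t x y * uy t x y).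
Proof.
intros eta et ex ey a b M He Ha Hab HM Hsupp.
c1 Hu; c1 He.
(* [Du] and [De] are (u(t+h)-u(t-h))/h and (eta(t+h)-eta(t))/h, extended to h = 0. [al] pairs the
   solution at times t and t+h in the bilinear form of the equation; [g] collects the derivatives
   falling on [eta]. *)
set (Du := fun h t x y => 2 * RInt (fun s => ut ((t + h - (t + - h)) * s + (t + - h)) x y) 0 1).
set (De := fun h t x y => RInt (fun s => et ((t + h - t) * s + t) x y) 0 1).
set (al := fun h t x y => - (ut t x y * ut (t + h) x y)
  + K x y * (ux t x y * ux (t + h) x y + uy t x y * uy (t + h) x y)).
set (g := fun t x y => - ut t x y * et t x y + K x y * ux t x y * ex t x y + K x y * uy t x y * ey t x y).
assert (HDu : forall h t x y, u (t + h) x y - u (t + - h) x y = h * Du h t x y).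
{ intros; rewrite (increment_integral (fun t => u t x y) (fun t => ut t x y));
    [unfold Du; ring | intro; apply (C1_t Hu) | cont]. }
assert (HDe : forall h t x y, eta (t + h) x y - eta t x y = h * De h t x y).
{ intros; rewrite (increment_integral (fun t => eta t x y) (fun t => et t x y));
    [unfold De; ring | intro; apply (C1_t He) | cont]. }
(* Widening the second interval by 1 on each side makes room for time shifts by h < 1. *)
set (Phi := fun h =>
  RInt (fun t => I2 M (fun x y => Du h t x y * g t x y)) a b
  - RInt (fun t => I2 M (fun x y => De h t x y * al h t x y)) (a - 1) (b + 1)).
assert (HPhi : forall h, 0 < h < 0 + 1 -> Phi h = 0).
{ intros h Hh.
  set (X := fun t => I2 M (fun x y => eta t x y * al h t x y)).
  set (Y := fun t => I2 M (fun x y => eta (t + h) x y * al h t x y)).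
  set (G := fun t => I2 M (fun x y => Du h t x y * g t x y)).
  assert (HX : Cont X) by (unfold X, I2, al; cont).
  assert (HY : Cont Y) by (unfold Y, I2, al; cont).
  assert (HG : Cont G) by (unfold G, I2, Du, g; cont).
  generalize (Hweak _ _ _ _ a b M (is_C1_mult _ _ _ _ _ _ _ _ He
    (is_C1_minus _ _ _ _ _ _ _ _ (is_C1_shift _ _ _ _ Hu h) (is_C1_shift _ _ _ _ Hu (- h))))
    Ha Hab HM).
  intro HW; rewrite box_int_I2 in HW.
  (* The pairing of u(t) with u(t-h) is [al] taken at time t-h; shifting time by h moves the
     difference from the solution to [eta]. *)
  rewrite (RInt_ext_R _ (fun t => (X t + (-1) * Y (t + - h)) + h * G t)) in HW.
  - rewrite (RInt_plus_Cont (fun t => X t + (-1) * Y (t + - h))),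
      (RInt_plus_Cont X), !RInt_scal_Cont, RInt_shift in HW by cont.
    rewrite <- (RInt_support X (a - 1) a b (b + 1)) in HW; try lra; trivial.
    + rewrite <- (RInt_support Y (a - 1) (a + - h) (b + - h) (b + 1)) in HW; try lra; trivial.
      * assert (HXY : RInt X (a - 1) (b + 1) + (-1) * RInt Y (a - 1) (b + 1) =
          (- h) * RInt (fun t => I2 M (fun x y => De h t x y * al h t x y)) (a - 1) (b + 1)).
        { rewrite <- !RInt_scal_Cont, <- RInt_plus_Cont by (unfold I2, De, al; cont).
          apply RInt_ext_R; intros t _; unfold X, Y.
          rewrite <- !I2_scal, <- I2_plus by (unfold De, al; cont).
          apply I2_ext; [lra|]; intros.
          replace (eta (t + h) x y) with (eta t x y + h * De h t x y)
            by (rewrite <- HDe; ring); ring. }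
        assert (HW' : h * Phi h = 0).
        { unfold Phi; fold G; rewrite <- HW by (intros; rewrite Hsupp by trivial; ring).
          rewrite HXY; as_R; ring. }
        destruct (Rmult_integral _ _ HW'); lra.
      * intros t Ht; unfold Y; apply I2_zero; [lra|]; intros x y _ _.
        rewrite (Hsupp (t + h)); [apply Rmult_0_l|].
        destruct Ht; [left | right; left]; lra.
    + intros t Ht; unfold X; apply I2_zero; [lra|]; intros x y _ _.
      rewrite (Hsupp t); [apply Rmult_0_l|].
      destruct Ht; [left | right; left]; lra.
  - intros t _; unfold X, Y, G.
    rewrite <- !I2_scal, <- !I2_plus by (unfold Du, g, al; cont).
    apply I2_ext; [lra|]; intros.
    rewrite !HDu; unfold al, g.
    replace (t + - h + h) with t by ring; ring. }
assert (HPhi0 : Phi 0 = 0).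
{ apply (eq_at_right Phi (fun _ => 0) 0 1); trivial; [lra | | cont].
  unfold Phi, I2, Du, De, al, g; cont. }
rewrite box_int_I2, <- HPhi0; unfold Phi.
assert (HD0 : forall t x y, Du 0 t x y = 2 * ut t x y).
{ intros; unfold Du; f_equal.
  rewrite (RInt_ext_R _ (fun _ => ut t x y)).
  - rewrite (RInt_const (V := R_CompleteNormedModule)).
    change ((1 - 0) * ut t x y = ut t x y); ring.
  - intros s _; f_equal; ring. }
assert (HE0 : forall t x y, De 0 t x y = et t x y).
{ intros; unfold De.
  rewrite (RInt_ext_R _ (fun _ => et t x y)).
  - rewrite (RInt_const (V := R_CompleteNormedModule)).
    change ((1 - 0) * et t x y = et t x y); ring.
  - intros s _; f_equal; ring. }
rewrite (RInt_support (fun t => I2 M (fun x y => De 0 t x y * al 0 t x y)) (a - 1) a b (b + 1));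
  [ | lra | lra | unfold I2, De, al; cont | ].
- set (U := RInt (fun t => I2 M (fun x y => Du 0 t x y * g t x y)) a b).
  set (V := RInt (fun t => I2 M (fun x y => De 0 t x y * al 0 t x y)) a b).
  replace (U - V) with (U + (-1) * V) by ring; unfold U, V.
  rewrite <- RInt_scal_Cont, <- RInt_plus_Cont by (unfold I2, Du, De, al, g; cont).
  apply RInt_ext_R; intros t _.
  rewrite <- I2_scal, <- I2_plus by (unfold Du, De, g, al; cont).
  apply I2_ext; [lra|]; intros.
  rewrite HD0, HE0; unfold g, al; rewrite !Rplus_0_r; ring.
- intros t Ht; apply I2_zero; [lra|]; intros; rewrite HE0.
  assert (Hz : et t x y = 0); [|rewrite Hz; ring].
  apply (is_derive_zero_loc (fun s => eta s x y) t _ (Rmax (a - t) (t - b))).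
  + destruct Ht; [eapply Rlt_le_trans; [|apply Rmax_l] | eapply Rlt_le_trans; [|apply Rmax_r]]; lra.
  + apply (C1_t He).
  + intros s Hs; apply Hsupp.
    destruct Ht; [rewrite Rmax_left in Hs by lra; left
                 | rewrite Rmax_right in Hs by lra; right; left]; lra.
Qed.

Lemma energy_identity z zt zx zy T M p q :
  is_C1 z zt zx zy -> 0 < M ->
  (forall t x y, 0 <= t <= T -> M <= Rabs x \/ M <= Rabs y -> z t x y = 0) ->
  0 <= p < q -> q <= T ->
  I2 M (fun x y => (ut q x y ^ 2 + K x y * (ux q x y ^ 2 + uy q x y ^ 2)) * z q x y)
  - I2 M (fun x y => (ut p x y ^ 2 + K x y * (ux p x y ^ 2 + uy p x y ^ 2)) * z p x y) =
  RInt (fun t => I2 M (fun x y =>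
    (ut t x y ^ 2 + K x y * (ux t x y ^ 2 + uy t x y ^ 2)) * zt t x y
    - 2 * K x y * ut t x y * (ux t x y * zx t x y + uy t x y * zy t x y))) p q.
Proof.
intros Hz HM Hsupp Hpq HqT; c1 Hu; c1 Hz.
assert (HI := fun H0 H1 H2 => weak_law_integrated _ _ _ _ _ _ _ T M p q H0 H1 H2
  energy_law Hz HM Hsupp Hpq HqT).
cbv beta in HI.
match type of HI with _ -> _ -> _ -> ?a - ?b = ?c =>
  assert (HI' : (-1) * a - (-1) * b = (-1) * c)
    by (assert (a - b = c) by (apply HI; cont); lra) end.
rewrite <- !I2_scal, <- RInt_scal_Cont in HI' by (unfold I2; cont).
etransitivity; [|etransitivity; [exact HI'|]].
- apply (f_equal2 Rminus); (apply I2_ext; [lra|]; intros; ring).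
- apply RInt_ext_R; intros t _; rewrite <- I2_scal by cont.
  apply I2_ext; [lra|]; intros; ring.
Qed.

End EnergyLaw.

(** * Finite speed of propagation *)

(** Squaring makes the positive part C^1, so that cutoffs built from it are admissible as test
    functions. *)
Definition pos2 (s : R) : R := Rmax 0 s ^ 2.

Lemma is_derive_pos2 s : is_derive pos2 s (2 * Rmax 0 s).
Proof.
destruct (Rtotal_order s 0) as [Hs|[->|Hs]].
- rewrite Rmax_left, Rmult_0_r by lra.
  apply (is_derive_ext_loc (fun _ => 0)); [|apply is_derive_const_R].
  assert (He : 0 < - s) by lra; exists (mkposreal _ He); intros y Hy.
  change (Rabs (y - s) < - s) in Hy; apply Rabs_def2 in Hy.
  unfold pos2; rewrite Rmax_left by lra; as_R; ring.
- rewrite Rmax_left, Rmult_0_r by lra.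
  apply is_derive_Reals; intros e He.
  exists (mkposreal _ He); intros h Hh Hlt; simpl in Hlt.
  unfold pos2; rewrite Rplus_0_l, (Rmax_left 0 0) by lra.
  unfold Rmax; destruct (Rle_dec 0 h).
  + replace ((h ^ 2 - 0 ^ 2) / h - 0) with h by (field; trivial); trivial.
  + replace ((0 ^ 2 - 0 ^ 2) / h - 0) with 0 by (field; trivial); now rewrite Rabs_R0.
- rewrite Rmax_right by lra.
  apply (is_derive_ext_loc (fun s => s ^ 2)); [|auto_derive; trivial; ring].
  exists (mkposreal _ Hs); intros y Hy.
  change (Rabs (y - s) < s) in Hy; apply Rabs_def2 in Hy.
  unfold pos2; rewrite Rmax_right by lra; as_R; ring.
Qed.

Lemma Cont_pos2' : Cont (fun s => 2 * Rmax 0 s).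
Proof. cont. Qed.

Lemma Cont_pos2 : Cont pos2.
Proof. unfold pos2; cont. Qed.

Lemma pos2_nonpos s : s <= 0 -> pos2 s = 0.
Proof. intro H; unfold pos2; rewrite Rmax_left by trivial; ring. Qed.

Lemma norm2_nonneg x y : 0 <= norm2 x y.
Proof. apply sqrt_pos. Qed.

Lemma norm2_sqr x y : norm2 x y ^ 2 = x ^ 2 + y ^ 2.
Proof. apply pow2_sqrt; nra. Qed.

Lemma norm2_Rabs_l x y : Rabs x <= norm2 x y.
Proof.
apply Rsqr_incr_0_var; [|apply norm2_nonneg].
rewrite <- Rsqr_abs, !Rsqr_pow2, norm2_sqr; nra.
Qed.

Lemma norm2_Rabs_r x y : Rabs y <= norm2 x y.
Proof.
apply Rsqr_incr_0_var; [|apply norm2_nonneg].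
rewrite <- Rsqr_abs, !Rsqr_pow2, norm2_sqr; nra.
Qed.

Lemma norm2_lt_sqr x y d : 0 <= d -> x ^ 2 + y ^ 2 < d ^ 2 -> norm2 x y < d.
Proof.
intros Hd H; apply Rsqr_incrst_0; [|apply norm2_nonneg|trivial].
now rewrite !Rsqr_pow2, norm2_sqr.
Qed.

Lemma cauchy_schwarz2 a b c d : a * c + b * d <= norm2 a b * norm2 c d.
Proof.
generalize (norm2_nonneg a b) (norm2_nonneg c d) (norm2_sqr a b) (norm2_sqr c d).
intros H1 H2 H3 H4.
apply Rsqr_incr_0_var; [|nra].
rewrite !Rsqr_pow2, Rpow_mult_distr, H3, H4.
generalize (pow2_ge_0 (a * d - b * c)); nra.
Qed.

Lemma norm2_triangle x y x0 y0 : norm2 x0 y0 <= norm2 x y + norm2 (x - x0) (y - y0).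
Proof.
generalize (norm2_nonneg x y) (norm2_nonneg (x - x0) (y - y0))
  (norm2_sqr x y) (norm2_sqr (x - x0) (y - y0)) (cauchy_schwarz2 x y (x0 - x) (y0 - y)).
intros H1 H2 H3 H4 H5.
replace (norm2 (x0 - x) (y0 - y)) with (norm2 (x - x0) (y - y0)) in H5
  by (unfold norm2; f_equal; ring).
apply Rsqr_incr_0_var; [|nra].
rewrite !Rsqr_pow2, norm2_sqr; nra.
Qed.

(* Dividing by tau, this says that the energy flux through the side of a
   characteristic cone is outgoing. *)
Lemma cone_flux c tau a b1 b2 X Y :
  0 < c -> 0 <= tau -> X ^ 2 + Y ^ 2 < c ^ 2 * tau ^ 2 ->
  0 <= tau * (a ^ 2 + c ^ 2 * (b1 ^ 2 + b2 ^ 2)) - 2 * a * (b1 * X + b2 * Y).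
Proof.
intros Hc Ht H.
assert (Htau : 0 < tau) by (destruct (Rle_lt_or_eq_dec _ _ Ht) as [|<-]; [trivial | nra]).
set (p := b1 * X + b2 * Y).
assert (Hp : p ^ 2 <= (b1 ^ 2 + b2 ^ 2) * (c ^ 2 * tau ^ 2)).
{ apply Rle_trans with ((b1 ^ 2 + b2 ^ 2) * (X ^ 2 + Y ^ 2)).
  - unfold p; generalize (pow2_ge_0 (b1 * Y - b2 * X)); nra.
  - apply Rmult_le_compat_l; nra. }
apply Rmult_le_reg_l with tau; [trivial|].
rewrite Rmult_0_r.
generalize (pow2_ge_0 (tau * a - p)); nra.
Qed.

Section FiniteSpeed.
Variables (K : R -> R -> R) (u ut ux uy : R -> R -> R -> R) (km c rho : R).
Hypothesis HK : cont2 K.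
Hypothesis Hkm : 0 < km.
Hypothesis Hlow : forall x y, km <= K x y.
Hypothesis Hc : 0 < c.
Hypothesis Hout : forall x y, rho < norm2 x y -> K x y = c ^ 2.
Hypothesis Hu : is_C1 u ut ux uy.
Hypothesis Hweak : weak_law (fun t x y => - ut t x y)
  (fun t x y => K x y * ux t x y) (fun t x y => K x y * uy t x y).
Hypothesis Hdata : forall x y, rho < norm2 x y ->
  u 0 x y = 0 /\ ut 0 x y = 0 /\ ux 0 x y = 0 /\ uy 0 x y = 0.

(** The energy is weighted by [pos2] of c^2 (t0-t)^2 - |x-x0|^2. Up to time t0 this weight lives on
    the backward cone, which stays where [K] is c^2, so the flux inequality keeps the weighted
    energy from growing beyond its initial value 0. On the axis below the apex the weight is
    positive, which forces the density to vanish. *)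
Lemma backward_cone q t0 x0 y0 :
  0 < q < t0 -> rho + c * t0 < norm2 x0 y0 ->
  ut q x0 y0 = 0 /\ ux q x0 y0 = 0 /\ uy q x0 y0 = 0.
Proof.
intros Hq Hx0; c1 Hu.
set (s := fun t x y => c ^ 2 * (t0 - t) ^ 2 - (x - x0) ^ 2 - (y - y0) ^ 2).
assert (Hs : is_C1 s (fun t _ _ => - 2 * c ^ 2 * (t0 - t))
   (fun _ x _ => - 2 * (x - x0)) (fun _ _ y => - 2 * (y - y0))).
{ unfold s; split; try cont; intros; auto_derive; trivial; ring. }
c1 Hs; assert (Hp2 := Cont_pos2).
assert (Hz := is_C1_comp _ _ _ _ Hs pos2 _ is_derive_pos2 Cont_pos2').
(* A square centred at the origin must contain the base of a cone centred at (x0, y0). *)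
set (M := Rabs x0 + Rabs y0 + c * t0 + 1).
assert (HM : 0 < M) by (unfold M; generalize (Rabs_pos x0) (Rabs_pos y0); nra).
assert (Hin : forall t x y, 0 <= t <= t0 -> 0 < s t x y -> rho < norm2 x y).
{ intros t x y Ht Hst; unfold s in Hst.
  assert (norm2 (x - x0) (y - y0) < c * (t0 - t)) by (apply norm2_lt_sqr; nra).
  generalize (norm2_triangle x y x0 y0); nra. }
assert (HI := fun Hsupp => energy_identity K u ut ux uy HK Hu Hweak _ _ _ _ t0 M 0 q
  Hz HM Hsupp ltac:(lra) ltac:(lra)).
assert (Hle : I2 M (fun x y => (ut q x y ^ 2 + K x y * (ux q x y ^ 2 + uy q x y ^ 2))
                * pos2 (s q x y)) <= 0).
{ assert (HF0 : I2 M (fun x y => (ut 0 x y ^ 2 + K x y * (ux 0 x y ^ 2 + uy 0 x y ^ 2))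
       * pos2 (s 0 x y)) = 0).
  { apply I2_zero; [lra|]; intros x y _ _.
    destruct (Rle_or_lt (s 0 x y) 0); [rewrite pos2_nonpos by trivial; ring|].
    destruct (Hdata x y) as [_ [-> [-> ->]]]; [apply (Hin 0); trivial; lra|]; ring. }
  cbv beta in HI; rewrite HF0, Rminus_0_r in HI; rewrite HI.
  - match goal with |- ?I <= 0 => assert (0 <= (-1) * I); [|lra] end.
    rewrite <- RInt_scal_Cont by (unfold I2; cont).
    apply RInt_ge_0_Cont; [lra | unfold I2; cont |].
    intros t Ht; rewrite <- I2_scal by cont.
    apply I2_ge_0; [lra | cont |]; intros x y _ _.
    destruct (Rle_or_lt (s t x y) 0) as [Hst|Hst].
    { rewrite Rmax_left by trivial; right; ring. }
    rewrite Rmax_right by lra.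
    rewrite (Hout x y) by (apply (Hin t); [lra | trivial]).
    assert (Hfl := cone_flux c (t0 - t) (ut t x y) (ux t x y) (uy t x y) (x - x0) (y - y0)
      Hc ltac:(lra) ltac:(unfold s in Hst; lra)).
    match goal with |- 0 <= ?e => replace e with (4 * c ^ 2 * s t x y *
      ((t0 - t) * (ut t x y ^ 2 + c ^ 2 * (ux t x y ^ 2 + uy t x y ^ 2)) -
         2 * ut t x y * (ux t x y * (x - x0) + uy t x y * (y - y0)))) by ring end.
    apply Rmult_le_pos; [|trivial].
    apply Rmult_le_pos; [nra | lra].
  - intros t x y Ht Hxy; apply pos2_nonpos; unfold s.
    assert (Hct : 0 <= c * (t0 - t) <= c * t0) by nra.
    assert (Hd : c * t0 + 1 <= norm2 (x - x0) (y - y0)).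
    { generalize (Rabs_pos x0) (Rabs_pos y0); unfold M in Hxy; intros.
      destruct Hxy as [Hx|Hy].
      - apply Rle_trans with (Rabs (x - x0)); [|apply norm2_Rabs_l].
        generalize (Rabs_triang_inv x x0); lra.
      - apply Rle_trans with (Rabs (y - y0)); [|apply norm2_Rabs_r].
        generalize (Rabs_triang_inv y y0); lra. }
    generalize (norm2_sqr (x - x0) (y - y0)); nra. }
assert (Hz0 : (ut q x0 y0 ^ 2 + K x0 y0 * (ux q x0 y0 ^ 2 + uy q x0 y0 ^ 2)) * pos2 (s q x0 y0) = 0).
{ assert (Hb : - M < x0 < M /\ - M < y0 < M).
  { unfold M; generalize (Rabs_pos x0) (Rabs_pos y0) (Rle_abs x0) (Rle_abs y0)
      (Rle_abs (- x0)) (Rle_abs (- y0)); rewrite !Rabs_Ropp; nra. }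
  apply (I2_nonneg_zero M (fun x y => (ut q x y ^ 2 + K x y * (ux q x y ^ 2 + uy q x y ^ 2))
                * pos2 (s q x y))); try apply Hb; trivial; [cont|].
  intros x y; apply Rmult_le_pos; [|apply pow2_ge_0].
  generalize (Hlow x y); nra. }
assert (Hpos : 0 < pos2 (s q x0 y0)).
{ assert (0 < s q x0 y0).
  { unfold s; replace (x0 - x0) with 0 by ring; replace (y0 - y0) with 0 by ring.
    assert (0 < c * (t0 - q)) by nra; nra. }
  unfold pos2; rewrite Rmax_right by lra; nra. }
destruct (Rmult_integral _ _ Hz0) as [He0|]; [|lra].
generalize (Hlow x0 y0) (pow2_ge_0 (ut q x0 y0)) (pow2_ge_0 (ux q x0 y0)) (pow2_ge_0 (uy q x0 y0)).
intros; repeat split.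
all: match goal with |- ?a = 0 => assert (a ^ 2 <= 0) by nra; nra end.
Qed.

Lemma finite_speed t x y :
  0 <= t -> rho + c * t < norm2 x y ->
  u t x y = 0 /\ ut t x y = 0 /\ ux t x y = 0 /\ uy t x y = 0.
Proof.
intros Ht Hxy.
assert (Hd : forall q, 0 <= q <= t -> ut q x y = 0 /\ ux q x y = 0 /\ uy q x y = 0).
{ intros q [[Hq|<-] Hqt].
  (* Any apex time strictly between [t] and [(norm2 x y - rho) / c] would do; this is the
     midpoint. *)
  - apply (backward_cone q ((t + (norm2 x y - rho) / c) / 2)).
    + assert (t < (norm2 x y - rho) / c); [|lra].
      apply Rmult_lt_reg_r with c; trivial; field_simplify; lra.
    + apply Rlt_le_trans with (rho + (c * t + (norm2 x y - rho)) / 2 + (norm2 x y - rho - c * t) / 2);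
        [|lra].
      replace (c * ((t + (norm2 x y - rho) / c) / 2)) with ((c * t + (norm2 x y - rho)) / 2)
        by (field; lra).
      lra.
  - apply Hdata; nra. }
split; [|apply Hd; lra].
assert (Hc0 : Cont (fun s => ut s x y)) by (generalize (C1_cont_t Hu); intro; cont).
generalize (RInt_is_derive (fun s => u s x y) (fun s => ut s x y) 0 t
  (fun s => C1_t Hu s x y) Hc0).
rewrite RInt_zero.
- destruct (Hdata x y) as [-> _]; [nra|lra].
- intros s; rewrite Rmin_left, Rmax_right by lra; intro; apply Hd; lra.
Qed.

End FiniteSpeed.

(** * Morawetz inequality *)

Lemma RInt_const_unit (f : R -> R) c : (forall s, f s = c) -> RInt f 0 1 = c.
Proof.
intro H; rewrite (RInt_ext_R f (fun _ => c)) by auto.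
rewrite (RInt_const (V := R_CompleteNormedModule)).
change ((1 - 0) * c = c); ring.
Qed.

Section Morawetz.
Variables (K Kx Ky : R -> R -> R) (u ut ux uy : R -> R -> R -> R) (T M0 : R).
Hypothesis HK : cont2 K.
Hypothesis HKx : cont2 Kx.
Hypothesis HKy : cont2 Ky.
Hypothesis HdKx : forall x y, is_derive (fun s => K s y) x (Kx x y).
Hypothesis HdKy : forall x y, is_derive (fun s => K x s) y (Ky x y).
Hypothesis Hrad : forall x y, x * Kx x y + y * Ky x y <= 0.
Hypothesis Hu : is_C1 u ut ux uy.
Hypothesis Hweak : weak_law (fun t x y => - ut t x y)
  (fun t x y => K x y * ux t x y) (fun t x y => K x y * uy t x y).
Hypothesis HT : 0 < T.
Hypothesis HM0 : 0 < M0.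
Hypothesis Hsupp : forall t x y, 0 <= t <= T -> M0 < norm2 x y ->
  u t x y = 0 /\ ut t x y = 0 /\ ux t x y = 0 /\ uy t x y = 0.

(** The dilations used have factors above 1/2, and half of [M] exceeds [M0]: outside this square the
    dilated solutions vanish too. *)
Let M := 2 * M0 + 2.

Lemma support_box t x y : 0 <= t <= T -> M0 < Rabs x \/ M0 < Rabs y ->
  u t x y = 0 /\ ut t x y = 0 /\ ux t x y = 0 /\ uy t x y = 0.
Proof.
intros Ht Hxy; apply Hsupp; trivial.
generalize (norm2_Rabs_l x y) (norm2_Rabs_r x y); destruct Hxy; lra.
Qed.

Let energy t := I2 M (fun x y => ut t x y ^ 2 + K x y * (ux t x y ^ 2 + uy t x y ^ 2)).

(** The weight 1 lacks compact support; it is replaced by a cutoff equal to 1 on the support of the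
    solution, whose gradient never meets the flux. *)
Lemma energy_conserved t : 0 <= t <= T -> energy t = energy 0.
Proof.
intros [[Ht|<-] HtT]; [|reflexivity].
c1 Hu; assert (Hp2 := Cont_pos2).
set (s := fun _ x y : R => x ^ 2 + y ^ 2 - M0 ^ 2).
assert (Hs : is_C1 s (fun _ _ _ => 0) (fun _ x _ => 2 * x) (fun _ _ y => 2 * y)).
{ unfold s; split; try cont; intros; auto_derive; trivial; ring. }
(* A C^1 step, equal to 1 on nonpositive arguments and to 0 from 1 on. *)
set (g := fun s => pos2 (1 - pos2 s)).
set (g' := fun s => 2 * Rmax 0 (1 - pos2 s) * - (2 * Rmax 0 s)).
assert (Hg : forall s, is_derive g s (g' s)).
{ intro r; apply (is_derive_comp_R pos2 (fun r => 1 - pos2 r)); [apply is_derive_pos2|].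
  replace (- (2 * Rmax 0 r)) with (0 - 2 * Rmax 0 r) by ring.
  apply is_derive_minus_R; [apply is_derive_const_R | apply is_derive_pos2]. }
assert (Hg'c : Cont g') by (unfold g'; cont).
assert (Hz := is_C1_comp _ _ _ _ Hs g g' Hg Hg'c).
assert (HM : 0 < M) by (unfold M; lra).
assert (HI := fun Hsupp => energy_identity K u ut ux uy HK Hu Hweak _ _ _ _ T M 0 t
  Hz HM Hsupp ltac:(lra) ltac:(lra)); cbv beta in HI.
assert (Hin : forall t x y, norm2 x y <= M0 -> s t x y <= 0).
{ intros r x y Hr; unfold s; generalize (norm2_sqr x y) (norm2_nonneg x y); nra. }
assert (He : forall t, 0 <= t <= T -> energy t = I2 M (fun x y =>
  (ut t x y ^ 2 + K x y * (ux t x y ^ 2 + uy t x y ^ 2)) * g (s t x y))).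
{ intros r Hr; unfold energy; apply I2_ext; [lra|]; intros x y _ _.
  destruct (Rlt_or_le M0 (norm2 x y)) as [Hn|Hn].
  - destruct (Hsupp r x y Hr Hn) as [_ [-> [-> ->]]]; ring.
  - unfold g; rewrite (pos2_nonpos (s r x y)) by auto.
    unfold pos2; rewrite Rmax_right by lra; ring. }
rewrite <- !He in HI by lra.
apply Rminus_diag_uniq; rewrite HI.
- apply RInt_zero; intro r; rewrite Rmin_left, Rmax_right by lra; intro Hr.
  apply I2_zero; [lra|]; intros x y _ _; unfold g'.
  destruct (Rlt_or_le M0 (norm2 x y)) as [Hn|Hn].
  + destruct (Hsupp r x y ltac:(lra) Hn) as [_ [-> [-> ->]]]; ring.
  + rewrite (Rmax_left 0 (s r x y)) by auto; ring.
- intros r x y Hr Hxy; apply pos2_nonpos.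
  assert (1 <= s r x y).
  { assert (M <= norm2 x y) by
      (generalize (norm2_Rabs_l x y) (norm2_Rabs_r x y); destruct Hxy; lra).
    unfold s; generalize (norm2_sqr x y); unfold M in *; nra. }
  unfold pos2; rewrite Rmax_right by lra; nra.
Qed.

(** The solution is itself C^1 with compact support in space, hence a legitimate test function: this
    is the multiplier [u], which compares kinetic with potential energy. *)
Lemma virial_identity :
  I2 M (fun x y => ut T x y * u T x y) - I2 M (fun x y => ut 0 x y * u 0 x y) =
  RInt (fun t => I2 M (fun x y =>
     ut t x y ^ 2 - K x y * (ux t x y ^ 2 + uy t x y ^ 2))) 0 T.
Proof.
c1 Hu.
assert (HM : 0 < M) by (unfold M; lra).
assert (HI : I2 M (fun x y => - ut T x y * u T x y) - I2 M (fun x y => - ut 0 x y * u 0 x y) =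
  RInt (fun t => I2 M (fun x y => - ut t x y * ut t x y + K x y * ux t x y * ux t x y
      + K x y * uy t x y * uy t x y)) 0 T).
{ apply (weak_law_integrated (fun t x y => - ut t x y) (fun t x y => K x y * ux t x y)
    (fun t x y => K x y * uy t x y) u ut ux uy T M 0 T);
    try cont; trivial; try lra.
  intros t x y Ht Hxy; apply (support_box t x y Ht); unfold M in Hxy; destruct Hxy; lra. }
rewrite (RInt_ext_R _ (fun t => (-1) * I2 M (fun x y =>
     ut t x y ^ 2 - K x y * (ux t x y ^ 2 + uy t x y ^ 2)))) in HI.
- rewrite RInt_scal_Cont in HI by (unfold I2; cont).
  rewrite (I2_ext M _ (fun x y => (-1) * (ut T x y * u T x y))),
   (I2_ext M (fun x y => - ut 0 x y * u 0 x y) (fun x y => (-1) * (ut 0 x y * u 0 x y))),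
   !I2_scal in HI by (cont || lra || (intros; ring)).
  lra.
- intros t _; rewrite <- I2_scal by cont; apply I2_ext; [lra|]; intros; ring.
Qed.

(* Noether's argument for spatial dilations: test with u(t, e^s x) - u(t, e^-s x)
   and divide by s. *)
Lemma dilation_identity :
  2 * I2 M (fun x y => ut T x y * (x * ux T x y + y * uy T x y))
  - 2 * I2 M (fun x y => ut 0 x y * (x * ux 0 x y + y * uy 0 x y)) =
  RInt (fun t => I2 M (fun x y => - 2 * ut t x y ^ 2
     + (x * Kx x y + y * Ky x y) * (ux t x y ^ 2 + uy t x y ^ 2))) 0 T.
Proof.
c1 Hu.
assert (HM : 0 < M) by (unfold M; lra).
(* [d], [DK] and [Du] extend to s = 0 the quotients (e^(2s)-1)/s, (K(e^s x)-K(x))/s and (u(e^s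
   x)-u(e^(-s) x))/(2s). *)
set (d := fun s => RInt (fun r => 2 * exp (2 * ((s - 0) * r + 0))) 0 1).
set (DK := fun s x y => RInt (fun r =>
  Kx (exp ((s - 0) * r + 0) * x) (exp ((s - 0) * r + 0) * y) * (exp ((s - 0) * r + 0) * x)
  + Ky (exp ((s - 0) * r + 0) * x) (exp ((s - 0) * r + 0) * y) * (exp ((s - 0) * r + 0) * y)) 0 1).
set (Du := fun s t x y => RInt (fun r =>
  ux t (exp ((s - - s) * r + - s) * x) (exp ((s - - s) * r + - s) * y)
    * (exp ((s - - s) * r + - s) * x)
  + uy t (exp ((s - - s) * r + - s) * x) (exp ((s - - s) * r + - s) * y)
    * (exp ((s - - s) * r + - s) * y)) 0 1).
assert (Hexp : forall x s, is_derive (fun s => exp s * x) s (exp s * x))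
  by (intros; auto_derive; trivial; ring).
assert (Hd : forall s, exp s ^ 2 - 1 = s * d s).
{ intro s; replace (exp s ^ 2 - 1) with (exp (2 * s) - exp (2 * 0)).
  - rewrite (increment_integral (fun s => exp (2 * s)) (fun s => 2 * exp (2 * s)));
      [unfold d; ring | intro; auto_derive; trivial; ring | cont].
  - rewrite Rmult_0_r, exp_0; replace (2 * s) with (s + s) by ring; rewrite exp_plus; ring. }
assert (HDK : forall s x y, K (exp s * x) (exp s * y) - K x y = s * DK s x y).
{ intros s x y.
  replace (K x y) with (K (exp 0 * x) (exp 0 * y)) by (rewrite exp_0, !Rmult_1_l; trivial).
  rewrite (increment_integral (fun s => K (exp s * x) (exp s * y))
    (fun s => Kx (exp s * x) (exp s * y) * (exp s * x) + Ky (exp s * x) (exp s * y) * (exp s * y)));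
    [unfold DK; ring | | cont].
  intro; apply (is_derive_comp2 K Kx Ky (fun s => exp s * x) (fun s => exp s * y)); auto. }
assert (HDu : forall s t x y, u t (exp s * x) (exp s * y) - u t (exp (- s) * x) (exp (- s) * y)
   = s * (2 * Du s t x y)).
{ intros s t x y.
  rewrite (increment_integral (fun s => u t (exp s * x) (exp s * y))
    (fun s => ux t (exp s * x) (exp s * y) * (exp s * x)
            + uy t (exp s * x) (exp s * y) * (exp s * y)));
    [unfold Du; ring | | cont].
  intro; apply (is_derive_comp2 (u t) (ux t) (uy t) (fun s => exp s * x) (fun s => exp s * y));
    [apply (C1_x Hu) | apply (C1_y Hu) | now apply cont3_slice | auto | auto]. }
set (Q := fun s t => I2 M (fun x y => ut t x y * (2 * Du s t x y))).
set (S := fun s => RInt (fun t => I2 M (fun x y =>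
   d s * (ut t x y * ut t (exp s * x) (exp s * y))
   - exp s * DK s x y * (ux t x y * ux t (exp s * x) (exp s * y)
                         + uy t x y * uy t (exp s * x) (exp s * y)))) 0 T).
(* Below ln 2 both dilation factors exceed 1/2, as the choice of [M] requires. *)
assert (HS : forall s, 0 < s < 0 + ln 2 -> Q s 0 - Q s T = S s).
{ intros s Hs.
  assert (Hl2 : exp s < 2) by (rewrite <- exp_ln by lra; apply exp_increasing; lra).
  assert (Hl1 : 1 < exp s) by (rewrite <- exp_0; apply exp_increasing; lra).
  assert (Hll : exp s * exp (- s) = 1)
    by (rewrite <- exp_plus, Rplus_opp_r; apply exp_0).
  assert (Hl' : / 2 < exp (- s) < 1) by (split; nra).
  set (l := exp s) in *; set (l' := exp (- s)) in *.
  assert (Hz := is_C1_minus _ _ _ _ _ _ _ _ (is_C1_dilate _ _ _ _ Hu l) (is_C1_dilate _ _ _ _ Hu l')).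
  assert (HI := fun A B C => weak_law_integrated (fun t x y => - ut t x y)
    (fun t x y => K x y * ux t x y) (fun t x y => K x y * uy t x y) _ _ _ _ T M 0 T
    A B C Hweak Hz HM).
  cbv beta in HI.
  assert (HsQ : s * (Q s 0 - Q s T) = s * S s); [|apply Rmult_eq_reg_l with s; lra].
  transitivity (I2 M (fun x y => - ut T x y * (u T (l * x) (l * y) - u T (l' * x) (l' * y))) -
      I2 M (fun x y => - ut 0 x y * (u 0 (l * x) (l * y) - u 0 (l' * x) (l' * y)))).
  { replace (s * (Q s 0 - Q s T)) with (- s * Q s T - - s * Q s 0) by ring.
    unfold Q; rewrite <- !I2_scal by (unfold Du; cont).
    apply (f_equal2 Rminus); apply I2_ext; try lra; intros x y _ _;
      unfold l, l'; rewrite HDu; ring. }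
  rewrite HI; try cont; try lra.
  - unfold S; rewrite <- RInt_scal_Cont by (unfold I2, d, DK, l; cont).
    apply RInt_ext_R; intros t; rewrite Rmin_left, Rmax_right by lra; intro Ht.
    set (f1 := fun x y => - (ut t x y * ut t (l * x) (l * y))
      + l * K x y * (ux t x y * ux t (l * x) (l * y) + uy t x y * uy t (l * x) (l * y))).
    set (g := fun x y => ut t (l * x) (l * y) * ut t x y
      - l' * K (l * x) (l * y) * (ux t (l * x) (l * y) * ux t x y + uy t (l * x) (l * y) * uy t x y)).
    assert (Hg : cont2 g) by (unfold g; cont).
    assert (Hg0 : forall x y, M0 + 1 <= Rabs x \/ M0 + 1 <= Rabs y -> g x y = 0).
    { intros x y Hxy; unfold g.
      destruct (support_box t x y) as [_ [-> [-> ->]]]; [lra | destruct Hxy; lra | ring]. }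
    (* The substitution turns the pairing of u(x) with u(l' x) into that of u(l x) with u(x), with
       Jacobian l^2 and [K] evaluated at l x. Against the other pairing only l^2 - 1 and K(l x) -
       K(x) remain. *)
    assert (Hgl : I2 M (fun x y => g (l' * x) (l' * y)) = l ^ 2 * I2 M g).
    { rewrite (I2_enlarge (M0 + 1) M g) by (trivial; unfold M; lra).
      rewrite <- (I2_enlarge (M0 + 1) (l' * M) g) by (trivial; unfold M; nra).
      rewrite <- I2_dilate, <- Rmult_assoc by trivial.
      replace (l ^ 2 * l' ^ 2) with ((l * l') ^ 2) by ring; rewrite Hll; ring. }
    transitivity (I2 M f1 + I2 M (fun x y => g (l' * x) (l' * y))).
    + rewrite <- I2_plus by (unfold f1, g; cont).
      apply I2_ext; [lra|]; intros x y _ _; unfold f1, g.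
      rewrite <- !Rmult_assoc, Hll, !Rmult_1_l; ring.
    + rewrite Hgl, <- !I2_scal, <- I2_plus by (unfold f1, d, DK, l; cont).
      apply I2_ext; [lra|]; intros x y _ _; unfold f1, g.
      replace (s * (d s * (ut t x y * ut t (exp s * x) (exp s * y)) -
        exp s * DK s x y * (ux t x y * ux t (exp s * x) (exp s * y)
                         + uy t x y * uy t (exp s * x) (exp s * y)))) with
       ((s * d s) * (ut t x y * ut t (exp s * x) (exp s * y)) -
        exp s * (s * DK s x y) * (ux t x y * ux t (exp s * x) (exp s * y)
                         + uy t x y * uy t (exp s * x) (exp s * y))) by ring.
      rewrite <- HDK, <- Hd; fold l.
      replace l' with (/ l) by (apply Rmult_eq_reg_l with l; [rewrite Hll; field|]; lra).
      field; lra.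
  - intros t x y Ht Hxy.
    assert (Hbig : forall k, / 2 < k -> M0 < Rabs (k * x) \/ M0 < Rabs (k * y)).
    { intros k Hk; rewrite !Rabs_mult, (Rabs_pos_eq k) by lra.
      unfold M in Hxy; destruct Hxy; [left | right]; nra. }
    destruct (support_box t (l * x) (l * y) Ht) as [-> _]; [apply Hbig; lra|].
    destruct (support_box t (l' * x) (l' * y) Ht) as [-> _]; [apply Hbig; lra|]; ring. }
assert (HS0 : Q 0 0 - Q 0 T = S 0).
{ apply (eq_at_right (fun s => Q s 0 - Q s T) S 0 (ln 2)); trivial.
  - rewrite <- ln_1; apply ln_increasing; lra.
  - unfold Q, I2, Du; cont.
  - unfold S, I2, d, DK; cont. }
assert (Hd0 : d 0 = 2).
{ apply RInt_const_unit; intro r.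
  replace (2 * ((0 - 0) * r + 0)) with 0 by ring; rewrite exp_0; ring. }
assert (HDK0 : forall x y, DK 0 x y = x * Kx x y + y * Ky x y).
{ intros; apply RInt_const_unit; intro r.
  replace ((0 - 0) * r + 0) with 0 by ring; rewrite exp_0, !Rmult_1_l; ring. }
assert (HDu0 : forall t x y, Du 0 t x y = x * ux t x y + y * uy t x y).
{ intros; apply RInt_const_unit; intro r.
  replace ((0 - - 0) * r + - 0) with 0 by ring; rewrite exp_0, !Rmult_1_l; ring. }
assert (HQ0 : forall t, Q 0 t = 2 * I2 M (fun x y => ut t x y * (x * ux t x y + y * uy t x y))).
{ intro t; unfold Q; rewrite <- I2_scal by cont.
  apply I2_ext; [lra|]; intros; rewrite HDu0; ring. }
rewrite !HQ0 in HS0.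
transitivity ((-1) * S 0); [rewrite <- HS0; ring|].
unfold S; rewrite <- RInt_scal_Cont by (unfold I2, d, DK; cont).
apply RInt_ext_R; intros t _.
rewrite <- I2_scal by (unfold d, DK; cont).
apply I2_ext; [lra|]; intros; rewrite Hd0, HDK0, exp_0, !Rmult_1_l; ring.
Qed.

(** Add the energy, integrated over [0,T] by conservation, to the dilation and virial identities:
    all quadratic terms cancel except (x.grad K)|grad u|^2, which is nonpositive. *)
Lemma morawetz_inequality :
  T * energy 0 + 2 * I2 M (fun x y => ut T x y * (x * ux T x y + y * uy T x y))
    + I2 M (fun x y => ut T x y * u T x y) <=
  2 * I2 M (fun x y => ut 0 x y * (x * ux 0 x y + y * uy 0 x y))
    + I2 M (fun x y => ut 0 x y * u 0 x y).
Proof.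
c1 Hu.
assert (HM : 0 < M) by (unfold M; lra).
assert (HE : T * energy 0 = RInt energy 0 T).
{ rewrite (RInt_ext_R energy (fun _ => energy 0)).
  - rewrite (RInt_const (V := R_CompleteNormedModule)).
    change (T * energy 0 = (T - 0) * energy 0); ring.
  - intros t; rewrite Rmin_left, Rmax_right by lra; intro; apply energy_conserved; lra. }
generalize dilation_identity virial_identity.
set (f1 := fun t => I2 M (fun x y => - 2 * ut t x y ^ 2
     + (x * Kx x y + y * Ky x y) * (ux t x y ^ 2 + uy t x y ^ 2))).
set (f2 := fun t => I2 M (fun x y => ut t x y ^ 2 - K x y * (ux t x y ^ 2 + uy t x y ^ 2))).
intros HP HN.
assert (Hsum : 0 <= (-1) * (RInt energy 0 T + RInt f1 0 T + RInt f2 0 T)).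
{ rewrite <- !RInt_plus_Cont, <- RInt_scal_Cont by (unfold energy, f1, f2, I2; cont).
  apply RInt_ge_0_Cont; [lra | unfold energy, f1, f2, I2; cont |].
  intros t _; unfold energy, f1, f2.
  rewrite <- !I2_plus, <- I2_scal by cont.
  apply I2_ge_0; [lra | cont |]; intros x y _ _.
  generalize (Hrad x y) (pow2_ge_0 (ux t x y)) (pow2_ge_0 (uy t x y)); nra. }
lra.
Qed.

End Morawetz.

(** * Logarithmic Poincare inequality *)

Lemma one_plus_sq_pos x y : 0 < 1 + (x ^ 2 + y ^ 2).
Proof. nra. Qed.

Lemma cont2_inv_one_plus_sq : cont2 (fun x y => / (1 + (x ^ 2 + y ^ 2))).
Proof. cont; intros p; apply Rgt_not_eq, one_plus_sq_pos. Qed.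

Lemma is_derive_arcsinh x : is_derive (fun x => ln (x + sqrt (1 + x ^ 2))) x (/ sqrt (1 + x ^ 2)).
Proof.
assert (H1 : 0 < 1 + x ^ 2) by nra.
assert (H2 : 0 < sqrt (1 + x ^ 2)) by now apply sqrt_lt_R0.
assert (H3 : 0 < x + sqrt (1 + x ^ 2)).
{ generalize (pow2_sqrt _ (Rlt_le _ _ H1)); nra. }
auto_derive; replace (x * (x * 1)) with (x ^ 2) by ring; [now repeat split |].
field; split; lra.
Qed.

(** The integral in y is at most pi / sqrt(1+x^2), with pi rounded up to 4; the integral in x is
    then a difference of arcsinh values, at most 2 ln(2M+1). *)
Lemma I2_inv_one_plus_sq M :
  0 < M -> I2 M (fun x y => / (1 + (x ^ 2 + y ^ 2))) <= 8 * ln (2 * M + 1).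
Proof.
intro HM; assert (Hc := cont2_inv_one_plus_sq).
assert (Ha : forall x, 0 < sqrt (1 + x ^ 2)) by (intro; apply sqrt_lt_R0; nra).
assert (Hac : Cont (fun x => / sqrt (1 + x ^ 2))).
{ cont; intro x; generalize (Ha x); lra. }
apply Rle_trans with (RInt (fun x => 4 * / sqrt (1 + x ^ 2)) (- M) M).
- apply RInt_le_Cont; [lra | cont; intros p; apply Rgt_not_eq, one_plus_sq_pos | cont |].
  + intro x; generalize (Ha x); lra.
  + intros x _; set (a := sqrt (1 + x ^ 2)); assert (Ha' : 0 < a) by apply Ha.
    assert (Ha2 : a ^ 2 = 1 + x ^ 2) by (apply pow2_sqrt; nra).
    rewrite (RInt_is_derive (fun y => / a * atan (y / a))).
    * assert (Hpi := PI_4); generalize (atan_bound (M / a)) (atan_bound (- M / a)).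
      intros H1 H2.
      replace (/ a * atan (M / a) - / a * atan (- M / a)) with
        ((atan (M / a) - atan (- M / a)) * / a) by ring.
      apply Rmult_le_compat_r; [left; now apply Rinv_0_lt_compat | lra].
    * intro y; auto_derive; [lra|].
      replace (1 + (x ^ 2 + y ^ 2)) with (a ^ 2 + y ^ 2) by (rewrite Ha2; ring).
      unfold Rsqr; field; repeat split; nra.
    * exact (cont2_slice2 _ x Hc).
- rewrite (RInt_scal_Cont _ 4) by trivial.
  rewrite (RInt_is_derive (fun x => ln (x + sqrt (1 + x ^ 2)))); trivial.
  2: apply is_derive_arcsinh.
  replace ((- M) ^ 2) with (M ^ 2) by ring.
  set (s := sqrt (1 + M ^ 2)).
  assert (Hs2 : s ^ 2 = 1 + M ^ 2) by (apply pow2_sqrt; nra).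
  assert (Hs : 0 < s) by apply Ha.
  assert (Hinv : - M + s = / (M + s)).
  { apply Rmult_eq_reg_l with (M + s); [|lra]; rewrite Rinv_r by lra; nra. }
  rewrite Hinv, ln_Rinv by lra.
  assert (ln (M + s) <= ln (2 * M + 1)); [|lra].
  destruct (Req_dec (M + s) (2 * M + 1)) as [->|]; [lra|].
  left; apply ln_increasing; [lra|]; nra.
Qed.

(* Logarithmic substitute for the two-dimensional Hardy inequality: integrate by
   parts against V = x/(1+|x|^2), for which div V = 2/(1+|x|^2)^2, and use the
   smooth version sqrt(1+w^2)-1 of |w|. *)
Lemma log_poincare M C del f w wx wy :
  0 < M -> 0 <= C -> 0 < del -> cont2 f -> cont2 w -> cont2 wx -> cont2 wy ->
  (forall x y, is_derive (fun s => w s y) x (wx x y)) ->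
  (forall x y, is_derive (fun s => w x s) y (wy x y)) ->
  (forall x y, M <= Rabs x \/ M <= Rabs y -> w x y = 0) ->
  (forall x y, Rabs (f x y) <= C * (2 * (/ (1 + (x ^ 2 + y ^ 2))) ^ 2)) ->
  I2 M (fun x y => f x y * w x y) <=
  I2 M (fun x y => Rabs (f x y))
   + C * (del * I2 M (fun x y => wx x y ^ 2 + wy x y ^ 2)
          + / (4 * del) * (8 * ln (2 * M + 1))).
Proof.
intros HM HC Hdel Hf Hw Hwx Hwy Hdx Hdy H0 Hfb.
assert (Hc := cont2_inv_one_plus_sq).
set (k := fun x y => / (1 + (x ^ 2 + y ^ 2))) in *.
assert (Hk : forall x y, 0 < k x y)
  by (intros; apply Rinv_0_lt_compat, one_plus_sq_pos).
(* The product w r is the derivative of sqrt(1+w^2) in w and is bounded by 1. Subtracting 1 in [phi]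
   below makes it vanish where [w] does, so that no boundary terms arise. *)
set (r := fun x y => / sqrt (1 + w x y ^ 2)).
assert (Hsp : forall x y, 1 <= sqrt (1 + w x y ^ 2)).
{ intros; rewrite <- sqrt_1 at 1; apply sqrt_le_1; nra. }
assert (Hr : cont2 r).
{ unfold r; cont; intro p; apply Rgt_not_eq, (Rlt_le_trans _ _ _ Rlt_0_1), Hsp. }
set (phi := fun x y => sqrt (1 + w x y ^ 2) - 1).
assert (Hphi : cont2 phi) by (unfold phi; cont).
assert (Hphi' : forall g x g', is_derive g x g' ->
   is_derive (fun s => sqrt (1 + g s ^ 2) - 1) x (g x * g' * / sqrt (1 + g x ^ 2))).
{ intros g x g' Hg.
  assert (0 < sqrt (1 + g x ^ 2)) by (apply sqrt_lt_R0; nra).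
  replace (g x * g' * / sqrt (1 + g x ^ 2)) with (g x * / sqrt (1 + g x ^ 2) * g') by ring.
  apply (is_derive_comp_R (fun z => sqrt (1 + z ^ 2) - 1) g); trivial.
  auto_derive; [nra|]; simpl in *; field; lra. }
assert (HI1 : I2 M (fun x y => (k x y - 2 * x ^ 2 * k x y ^ 2) * phi x y
    + x * k x y * (w x y * wx x y * r x y)) = 0).
{ apply (I2_dx M (fun x y => x * k x y * phi x y)); try cont; try lra.
  - intros x y; apply (is_derive_mult_R (fun s => s * k s y) (fun s => phi s y)).
    + unfold k; generalize (one_plus_sq_pos x y); intro.
      auto_derive; [simpl in *; lra|]; simpl in *; field; simpl in *; lra.
    + apply (Hphi' (fun s => w s y)); apply Hdx.
  - intros x y Hx; unfold phi; rewrite H0 by auto.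
    replace (1 + 0 ^ 2) with 1 by ring; rewrite sqrt_1; ring. }
assert (HI2 : I2 M (fun x y => (k x y - 2 * y ^ 2 * k x y ^ 2) * phi x y
    + y * k x y * (w x y * wy x y * r x y)) = 0).
{ apply (I2_dy M (fun x y => y * k x y * phi x y)); try cont; try lra.
  - intros x y; apply (is_derive_mult_R (fun s => s * k x s) (fun s => phi x s)).
    + unfold k; generalize (one_plus_sq_pos x y); intro.
      auto_derive; [simpl in *; lra|]; simpl in *; field; simpl in *; lra.
    + apply (Hphi' (fun s => w x s)); apply Hdy.
  - intros x y Hx; unfold phi; rewrite H0 by auto.
    replace (1 + 0 ^ 2) with 1 by ring; rewrite sqrt_1; ring. }
assert (Hlog := I2_inv_one_plus_sq M HM); fold k in Hlog.
apply Rle_trans with (I2 M (fun x y => Rabs (f x y))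
   + C * (del * I2 M (fun x y => wx x y ^ 2 + wy x y ^ 2) + / (4 * del) * I2 M k)).
2: { apply Rplus_le_compat_l, Rmult_le_compat_l; trivial.
     apply Rplus_le_compat_l, Rmult_le_compat_l; trivial.
     left; apply Rinv_0_lt_compat; lra. }
(* Adding the two vanishing integrals, whose sum is the integral of div(phi V), makes the inequality
   hold pointwise under the integral. *)
rewrite <- (Rplus_0_r (del * _ + _)).
replace 0 with (0 + 0) by ring; rewrite <- HI1 at 1; rewrite <- HI2.
rewrite <- (I2_scal M del), <- (I2_scal M (/ (4 * del)) k), <- !I2_plus, <- I2_scal, <- I2_plus by cont.
apply I2_le; [lra | cont | cont |]; intros x y _ _.
set (kk := k x y); set (W := w x y); set (a := wx x y); set (b := wy x y); set (rr := r x y).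
assert (Hkr : kk * (1 + (x ^ 2 + y ^ 2)) = 1).
{ unfold kk, k; apply Rinv_l; generalize (one_plus_sq_pos x y); lra. }
assert (Hkp : 0 < kk) by apply Hk.
assert (Hrange : (W * rr) ^ 2 <= 1).
{ unfold rr, r; fold W; rewrite Rpow_mult_distr, pow_inv, pow2_sqrt by nra.
  apply Rmult_le_reg_r with (1 + W ^ 2); [nra|].
  rewrite Rmult_assoc, Rinv_l by nra; nra. }
(* The excess 1 here is what produces the integral of |f|. *)
assert (HW : Rabs W <= phi x y + 1).
{ unfold phi; fold W; replace (sqrt (1 + W ^ 2) - 1 + 1) with (sqrt (1 + W ^ 2)) by ring.
  rewrite <- sqrt_Rsqr_abs; apply sqrt_le_1; unfold Rsqr; nra. }
assert (Hphi0 : 0 <= phi x y) by (unfold phi; generalize (Hsp x y); lra).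
assert (Hdiv : (kk - 2 * x ^ 2 * kk ^ 2) + (kk - 2 * y ^ 2 * kk ^ 2) = 2 * kk ^ 2) by nra.
(* Young's inequality for V . (w r grad w), using |w r| <= 1 and |V|^2 <= 1/(1+|x|^2), in the form
   of completed squares. *)
assert (Hflux : 0 <= del * (a ^ 2 + b ^ 2) + / (4 * del) * kk
   + (x * kk * (W * a * rr) + y * kk * (W * b * rr))).
{ set (q := W * rr) in *.
  assert (Hid : / (4 * del) * (4 * del) = 1) by (apply Rinv_l; lra).
  assert (Hip : 0 < / (4 * del)) by (apply Rinv_0_lt_compat; lra).
  set (i := / (4 * del)) in *.
  apply Rle_trans with (del * (a * q + 2 * i * (x * kk)) ^ 2 + del * (b * q + 2 * i * (y * kk)) ^ 2).
  { apply Rplus_le_le_0_compat; apply Rmult_le_pos; try lra; apply pow2_ge_0. }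
  replace (x * kk * (W * a * rr) + y * kk * (W * b * rr)) with
    (kk * q * (x * a + y * b)) by (unfold q; ring).
  replace (del * (a * q + 2 * i * (x * kk)) ^ 2 + del * (b * q + 2 * i * (y * kk)) ^ 2) with
    (del * (a ^ 2 + b ^ 2) * q ^ 2 + (i * (4 * del)) * i * (kk * (kk * (x ^ 2 + y ^ 2)))
       + (i * (4 * del)) * (kk * q * (x * a + y * b))) by ring.
  rewrite Hid, !Rmult_1_l.
  assert (del * (a ^ 2 + b ^ 2) * q ^ 2 <= del * (a ^ 2 + b ^ 2)).
  { rewrite <- (Rmult_1_r (del * (a ^ 2 + b ^ 2))) at 2.
    apply Rmult_le_compat_l; trivial; apply Rmult_le_pos; nra. }
  assert (i * (kk * (kk * (x ^ 2 + y ^ 2))) <= i * kk).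
  { apply Rmult_le_compat_l; [lra|].
    rewrite <- (Rmult_1_r kk) at 3; apply Rmult_le_compat_l; nra. }
  lra. }
apply Rle_trans with (Rabs (f x y) + C * (2 * kk ^ 2 * phi x y)).
- apply Rle_trans with (Rabs (f x y) * Rabs W); [rewrite <- Rabs_mult; apply Rle_abs|].
  apply Rle_trans with (Rabs (f x y) * (phi x y + 1)).
  + apply Rmult_le_compat_l; [apply Rabs_pos | trivial].
  + rewrite Rmult_plus_distr_l, Rmult_1_r, (Rplus_comm (Rabs _)).
    apply Rplus_le_compat_r.
    rewrite <- Rmult_assoc; apply Rmult_le_compat_r; trivial; apply Hfb.
- apply Rplus_le_compat_l, Rmult_le_compat_l; trivial.
  rewrite <- Hdiv; lra.
Qed.

(** * Growth of the L2 norm *)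

Section L2Bound.
Variables (K : R -> R -> R) (u ut ux uy : R -> R -> R -> R) (T M km C : R).
Hypothesis HK : cont2 K.
Hypothesis Hkm : 0 < km.
Hypothesis Hlow : forall x y, km <= K x y.
Hypothesis Hu : is_C1 u ut ux uy.
Hypothesis Hweak : weak_law (fun t x y => - ut t x y)
  (fun t x y => K x y * ux t x y) (fun t x y => K x y * uy t x y).
Hypothesis HT : 0 < T.
Hypothesis HM : 0 < M.
Hypothesis Hsupp : forall t x y, 0 <= t <= T -> M <= Rabs x \/ M <= Rabs y -> u t x y = 0.

Let w t x y : R := RInt (fun s => u s x y) 0 t.
Let wx t x y : R := RInt (fun s => ux s x y) 0 t.
Let wy t x y : R := RInt (fun s => uy s x y) 0 t.

(* The time integral w of u satisfies w_tt - div (K grad w) = u_t(0), with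
   w_t = u; this is its energy identity. *)
Lemma l2_identity :
  I2 M (fun x y => u T x y ^ 2 + K x y * (wx T x y ^ 2 + wy T x y ^ 2)) =
  I2 M (fun x y => u 0 x y ^ 2) + 2 * I2 M (fun x y => ut 0 x y * w T x y).
Proof.
c1 Hu.
(* The source u_t(0) does not depend on time, so its work is an exact time derivative and can be put
   into the conserved density. *)
set (e := fun t x y => u t x y ^ 2 + K x y * (wx t x y ^ 2 + wy t x y ^ 2)
   - 2 * (ut 0 x y * w t x y)).
set (e' := fun t x y => 2 * (u t x y * ut t x y) +
   K x y * (2 * wx t x y * ux t x y + 2 * wy t x y * uy t x y) - 2 * (ut 0 x y * u t x y)).
set (Y := fun t => I2 M (e t)).
set (Y' := fun t => I2 M (e' t)).
assert (Hw : forall f, cont3 f -> forall t x y,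
  is_derive (fun t => RInt (fun s => f s x y) 0 t) t (f t x y)).
{ intros f Hf t x y; apply (is_derive_RInt_upper (fun s => f s x y)); cont. }
assert (Hsq : forall f t f', is_derive f t f' -> is_derive (fun t => f t ^ 2) t (2 * f t * f')).
{ intros f t f' Hf; apply (is_derive_comp_R (fun s => s ^ 2) f); trivial.
  auto_derive; trivial; ring. }
assert (HY : forall t, is_derive Y t (Y' t)).
{ apply (is_derive_I2 M e e'); [unfold e, w, wx, wy; cont | unfold e', wx, wy; cont |].
  intros t x y; unfold e, e'.
  apply is_derive_minus_R; [apply is_derive_plus_R|].
  - replace (2 * (u t x y * ut t x y)) with (2 * u t x y * ut t x y) by ring.
    apply (Hsq (fun t => u t x y)); apply (C1_t Hu).
  - replace (K x y * (2 * wx t x y * ux t x y + 2 * wy t x y * uy t x y)) with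
      (0 * (wx t x y ^ 2 + wy t x y ^ 2) + K x y * (2 * wx t x y * ux t x y + 2 * wy t x y * uy t x y)) by ring.
    apply (is_derive_mult_R (fun _ => K x y) (fun t => wx t x y ^ 2 + wy t x y ^ 2)); [apply is_derive_const_R|].
    apply is_derive_plus_R; [apply (Hsq (fun t => wx t x y)) | apply (Hsq (fun t => wy t x y))];
      now apply Hw.
  - replace (2 * (ut 0 x y * u t x y)) with (0 * (ut 0 x y * w t x y) +
      2 * (0 * w t x y + ut 0 x y * u t x y)) by ring.
    apply (is_derive_mult_R (fun _ => 2) (fun t => ut 0 x y * w t x y)); [apply is_derive_const_R|].
    apply (is_derive_mult_R (fun _ => ut 0 x y) (fun t => w t x y)); [apply is_derive_const_R|].
    now apply (Hw u). }
assert (HY' : Cont Y') by (unfold Y', I2, e', wx, wy; cont).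
assert (HY0 : forall t, 0 < t < T -> Y' t = 0).
{ intros t Ht.
  assert (HI : I2 M (fun x y => - ut t x y * u t x y) - I2 M (fun x y => - ut 0 x y * u t x y) =
    RInt (fun s => I2 M (fun x y => - ut s x y * 0 + K x y * ux s x y * ux t x y
      + K x y * uy s x y * uy t x y)) 0 t).
  { apply (weak_law_integrated (fun t x y => - ut t x y) (fun t x y => K x y * ux t x y)
      (fun t x y => K x y * uy t x y) (fun _ x y => u t x y) (fun _ _ _ => 0)
      (fun _ x y => ux t x y) (fun _ x y => uy t x y) t M 0 t);
      [cont | cont | cont | trivial | exact (is_C1_freeze _ _ _ _ Hu t) | trivial | | lra | lra].
    intros s x y _ Hxy; apply Hsupp; trivial; lra. }
  rewrite (I2_RInt M (fun s x y => - ut s x y * 0 + K x y * ux s x y * ux t x y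
      + K x y * uy s x y * uy t x y)) in HI by cont.
  rewrite (I2_ext M (fun x y => RInt _ 0 t)
    (fun x y => K x y * (wx t x y * ux t x y + wy t x y * uy t x y))) in HI; [|lra|].
  - unfold Y', e'.
    apply Rmult_eq_reg_l with (/ 2); [|lra].
    rewrite <- I2_scal, Rmult_0_r by (unfold wx, wy; cont).
    apply Rminus_diag_eq in HI.
    match type of HI with ?a - ?b - ?c = 0 =>
      assert (HI' : (-1) * a + ((-1) * ((-1) * b) + c) = 0) by lra end.
    rewrite <- !I2_scal, <- !I2_plus in HI' by (unfold wx, wy; cont).
    etransitivity; [|exact HI']; apply I2_ext; [lra|]; intros; field.
  - intros x y _ _.
    rewrite (RInt_ext_R _ (fun s => (K x y * ux t x y) * ux s x y + (K x y * uy t x y) * uy s x y))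
      by (intros; as_R; ring).
    rewrite RInt_plus_Cont, !RInt_scal_Cont by cont; unfold wx, wy; as_R; ring. }
assert (HYT : Y T = Y 0).
{ apply Rminus_diag_uniq; rewrite <- (RInt_is_derive Y Y' 0 T HY HY').
  apply RInt_zero; intro; rewrite Rmin_left, Rmax_right by lra; apply HY0. }
assert (HY00 : Y 0 = I2 M (fun x y => u 0 x y ^ 2)).
{ unfold Y; apply I2_ext; [lra|]; intros; unfold e, w, wx, wy.
  rewrite !(RInt_point (V := R_CompleteNormedModule)).
  change (@zero R_CompleteNormedModule) with 0; ring. }
rewrite <- HY00, <- HYT, <- I2_scal by (unfold w; cont).
unfold Y; rewrite <- I2_plus by (unfold e, w, wx, wy; cont).
apply I2_ext; [lra|]; intros; unfold e; ring.
Qed.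

Hypothesis HC : 0 < C.
Hypothesis Hu1 : forall x y, Rabs (ut 0 x y) <= C * (2 * (/ (1 + (x ^ 2 + y ^ 2))) ^ 2).

(** With [del] equal to km/(2C), the gradient term of the logarithmic inequality is absorbed exactly
    by the lower bound km |grad w|^2 of the potential energy of [w]. *)
Lemma l2_bound :
  I2 M (fun x y => u T x y ^ 2) <=
  I2 M (fun x y => u 0 x y ^ 2) + 2 * I2 M (fun x y => Rabs (ut 0 x y))
  + 8 * C ^ 2 / km * ln (2 * M + 1).
Proof.
c1 Hu.
assert (Hut0 : cont2 (ut 0)) by (now apply cont3_slice).
assert (HL : I2 M (fun x y => ut 0 x y * w T x y) <=
  I2 M (fun x y => Rabs (ut 0 x y))
   + C * (km / (2 * C) * I2 M (fun x y => wx T x y ^ 2 + wy T x y ^ 2)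
          + / (4 * (km / (2 * C))) * (8 * ln (2 * M + 1)))).
{ apply (log_poincare M C (km / (2 * C)) (ut 0) (w T) (wx T) (wy T));
    trivial; try lra; try (unfold w, wx, wy; cont).
  - apply Rdiv_lt_0_compat; lra.
  - intros x y; apply (is_derive_RInt_Cont (fun z s => u s z y) (fun z s => ux s z y)); try cont.
    intros; apply (C1_x Hu).
  - intros x y; apply (is_derive_RInt_Cont (fun z s => u s x z) (fun z s => uy s x z)); try cont.
    intros; apply (C1_y Hu).
  - intros x y Hxy; apply RInt_zero; intro s; rewrite Rmin_left, Rmax_right by lra.
    intro; apply Hsupp; trivial; lra. }
assert (HG : km * I2 M (fun x y => wx T x y ^ 2 + wy T x y ^ 2) <=
  I2 M (fun x y => K x y * (wx T x y ^ 2 + wy T x y ^ 2))).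
{ rewrite <- I2_scal by (unfold wx, wy; cont).
  apply I2_le; [lra | unfold wx, wy; cont | unfold wx, wy; cont |]; intros.
  apply Rmult_le_compat_r; [nra | apply Hlow]. }
generalize l2_identity.
rewrite I2_plus by (unfold wx, wy; cont).
replace (C * (km / (2 * C) * I2 M (fun x y => wx T x y ^ 2 + wy T x y ^ 2)
          + / (4 * (km / (2 * C))) * (8 * ln (2 * M + 1)))) with
  (/ 2 * (km * I2 M (fun x y => wx T x y ^ 2 + wy T x y ^ 2)) + / 2 * (8 * C ^ 2 / km * ln (2 * M + 1)))
  in HL by (field; lra).
lra.
Qed.

End L2Bound.

(** * Decay of the local energy *)

(* The radii delta(u,v) given to the compactness lemma are also at most
   1/(1+|f(u,v)|), so that the resulting uniform radius bounds |f|. *)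
Lemma bounded_on_box (f : R -> R -> R) m :
  cont2 f -> exists B, forall x y, - m <= x <= m -> - m <= y <= m -> Rabs (f x y) <= B.
Proof.
intro Hf.
assert (Hd : forall x y, exists d : posreal, d <= / (1 + Rabs (f x y)) /\
  forall x' y', Rabs (x' - x) < d -> Rabs (y' - y) < d -> Rabs (f x' y' - f x y) < 1).
{ intros x y.
  generalize (proj1 (filterlim_locally _ _) (Hf x y) (mkposreal _ Rlt_0_1)); intros [d Hd].
  assert (Hp : 0 < Rmin d (/ (1 + Rabs (f x y)))).
  { apply Rmin_glb_lt; [apply cond_pos|].
    apply Rinv_0_lt_compat; generalize (Rabs_pos (f x y)); lra. }
  exists (mkposreal _ Hp); simpl; split; [apply Rmin_r|].
  intros x' y' Hx Hy; apply (Hd (x', y')).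
  split; [apply Rlt_le_trans with (1 := Hx) | apply Rlt_le_trans with (1 := Hy)]; apply Rmin_l. }
set (delta := fun x y => proj1_sig (constructive_indefinite_description _ (Hd x y))).
assert (Hdelta := fun x y => proj2_sig (constructive_indefinite_description _ (Hd x y))).
destruct (compactness_value_2d (- m) m (- m) m delta) as [d Hc].
exists (1 + / d); intros x y Hx Hy.
destruct (NNPP _ (Hc x y Hx Hy)) as [a [b [_ [_ [Ha [Hb Hle]]]]]].
destruct (Hdelta a b) as [H1 H2]; fold (delta a b) in H1, H2.
specialize (H2 x y Ha Hb).
assert (Hfb : Rabs (f a b) <= / d).
{ assert (Hp : 0 < 1 + Rabs (f a b)) by (generalize (Rabs_pos (f a b)); lra).
  assert (Hd1 : d <= / (1 + Rabs (f a b))) by lra.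
  apply Rle_trans with (1 + Rabs (f a b)); [lra|].
  rewrite <- (Rinv_inv (1 + _)).
  apply Rinv_le_contravar; [apply cond_pos | trivial]. }
generalize (Rabs_triang (f x y - f a b) (f a b)).
replace (f x y - f a b + f a b) with (f x y) by ring; lra.
Qed.

Lemma RInt_symmetric_mono (f : R -> R) s M :
  0 <= s <= M -> Cont f -> (forall x, 0 <= f x) -> RInt f (- s) s <= RInt f (- M) M.
Proof.
intros Hs Hf Hpos.
rewrite <- (RInt_Chasles_Cont f (- M) (- s) M), <- (RInt_Chasles_Cont f (- s) s M) by trivial.
assert (0 <= RInt f (- M) (- s)) by (apply RInt_ge_0_Cont; auto; lra).
assert (0 <= RInt f s M) by (apply RInt_ge_0_Cont; auto; lra).
lra.
Qed.

(** Passes from the disc of the local energy to the squares used elsewhere. *)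
Lemma RInt_disc_le (f g : R -> R -> R) r M :
  0 < r <= M -> cont2 f -> cont2 g -> (forall x y, 0 <= g x y) ->
  (forall x y, norm2 x y <= r -> f x y = g x y) ->
  RInt (fun x => RInt (fun y => f x y) (- sqrt (r ^ 2 - x ^ 2)) (sqrt (r ^ 2 - x ^ 2))) (- r) r
  <= I2 M g.
Proof.
intros Hr Hf Hg Hpos Hfg.
apply Rle_trans with (RInt (fun x => RInt (fun y => g x y) (- M) M) (- r) r).
- apply RInt_le_Cont; [lra | cont | cont |]; intros x Hx.
  set (s := sqrt (r ^ 2 - x ^ 2)).
  assert (Hs : 0 <= s) by apply sqrt_pos.
  assert (Hs2 : s ^ 2 = r ^ 2 - x ^ 2) by (apply pow2_sqrt; nra).
  rewrite (RInt_ext_R (fun y => f x y) (fun y => g x y)).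
  + apply RInt_symmetric_mono; [split; [trivial | nra] | exact (cont2_slice2 g x Hg) | auto].
  + intros y; rewrite Rmin_left, Rmax_right by lra; intro Hy; apply Hfg.
    apply Rsqr_incr_0_var; [|lra]; rewrite !Rsqr_pow2, norm2_sqr; nra.
- apply RInt_symmetric_mono; [lra | cont |].
  intro x; apply RInt_ge_0_Cont; [lra | exact (cont2_slice2 g x Hg) | auto].
Qed.

Lemma momentum_bound c r a b1 b2 X Y :
  0 < c -> norm2 X Y <= r ->
  - (2 * (a * (X * b1 + Y * b2))) <= r / c * (a ^ 2 + c ^ 2 * (b1 ^ 2 + b2 ^ 2)).
Proof.
intros Hc Hr.
set (B := norm2 b1 b2); assert (HB : B ^ 2 = b1 ^ 2 + b2 ^ 2) by apply norm2_sqr.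
assert (HB0 : 0 <= B) by apply norm2_nonneg.
generalize (norm2_nonneg X Y); intro Hn.
set (p := X * b1 + Y * b2).
assert (Hp : Rabs p <= norm2 X Y * B).
{ apply Rabs_le; split; [|apply cauchy_schwarz2].
  generalize (cauchy_schwarz2 (- X) (- Y) b1 b2).
  replace (norm2 (- X) (- Y)) with (norm2 X Y) by (unfold norm2; f_equal; ring).
  fold B; unfold p; lra. }
rewrite <- HB.
apply Rle_trans with (2 * (Rabs a * Rabs p)).
{ rewrite <- Rabs_mult; generalize (Rle_abs (- (a * p))); rewrite Rabs_Ropp; lra. }
apply Rle_trans with (r * (2 * (Rabs a * B))).
{ assert (Rabs a * Rabs p <= Rabs a * (r * B)); [|lra].
  apply Rmult_le_compat_l; [apply Rabs_pos|].
  apply Rle_trans with (1 := Hp); now apply Rmult_le_compat_r. }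
unfold Rdiv; rewrite Rmult_assoc; apply Rmult_le_compat_l; [lra|].
apply Rmult_le_reg_l with c; trivial.
rewrite <- (Rmult_assoc c (/ c)), Rinv_r, Rmult_1_l by lra.
rewrite <- (pow2_abs a); generalize (pow2_ge_0 (Rabs a - c * B)); nra.
Qed.

Section Decay.
Variables (K Kx Ky : R -> R -> R) (u ut ux uy : R -> R -> R -> R) (km c r0 rho Rr : R).
Hypothesis HK : cont2 K.
Hypothesis HKx : cont2 Kx.
Hypothesis HKy : cont2 Ky.
Hypothesis HdKx : forall x y, is_derive (fun s => K s y) x (Kx x y).
Hypothesis HdKy : forall x y, is_derive (fun s => K x s) y (Ky x y).
Hypothesis Hrad : forall x y, x * Kx x y + y * Ky x y <= 0.
Hypothesis Hkm : 0 < km.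
Hypothesis Hlow : forall x y, km <= K x y.
Hypothesis Hc : 0 < c.
Hypothesis Hr0 : 0 < r0 <= rho.
Hypothesis HR : r0 < Rr.
Hypothesis Hout : forall x y, r0 < norm2 x y -> K x y = c ^ 2.
Hypothesis Hu : is_C1 u ut ux uy.
Hypothesis Hweak : weak_law (fun t x y => - ut t x y)
  (fun t x y => K x y * ux t x y) (fun t x y => K x y * uy t x y).
Hypothesis Hdata : forall x y, rho < norm2 x y ->
  u 0 x y = 0 /\ ut 0 x y = 0 /\ ux 0 x y = 0 /\ uy 0 x y = 0.

(** A continuous substitute for the indicator of the disc of radius [Rr], since the calculus on
    squares is for continuous integrands. *)
Let chi x y := Rmax 0 (Rmin 1 (Rr + 1 - norm2 x y)).
(** The first summand bounds the radial momentum for |x| <= Rr + 1, where 1 + 1/km converts u_t^2 +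
    |grad u|^2 into energy. The second is the excess over T of (rho + c T)/c, the support radius
    divided by the speed. *)
Let kap := (Rr + 1) * (1 + / km) + rho / c.

Lemma cont2_chi : cont2 chi.
Proof. unfold chi, norm2; cont. Qed.

Lemma chi_range x y : 0 <= chi x y <= 1.
Proof.
unfold chi; split; [apply Rmax_l|].
apply Rmax_lub; [lra | apply Rmin_l].
Qed.

(** Write e for the energy density. For |x| <= Rr + 1 the momentum costs a constant times e, so T e
    survives. Farther out but inside the light cone it may use up (|x|/c) e <= (T + rho/c) e, but
    there [chi] is 0. Outside the cone everything vanishes. *)
Lemma cutoff_energy_bound T x y :
  0 <= T ->
  T * (chi x y * (ut T x y ^ 2 + K x y * (ux T x y ^ 2 + uy T x y ^ 2))) <=
  (T + kap) * (ut T x y ^ 2 + K x y * (ux T x y ^ 2 + uy T x y ^ 2))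
  + 2 * (ut T x y * (x * ux T x y + y * uy T x y)).
Proof.
intro HT.
assert (Hout' : forall x y, rho < norm2 x y -> K x y = c ^ 2) by (intros; apply Hout; lra).
assert (Hrc : 0 < rho / c) by (apply Rdiv_lt_0_compat; lra).
assert (Hkmi : 0 < / km) by now apply Rinv_0_lt_compat.
assert (Hk1 : 0 < (Rr + 1) * (1 + / km)) by nra.
generalize (Hlow x y) (pow2_ge_0 (ut T x y)) (pow2_ge_0 (ux T x y)) (pow2_ge_0 (uy T x y)).
intros HKl Ha Hb1 Hb2.
set (e := ut T x y ^ 2 + K x y * (ux T x y ^ 2 + uy T x y ^ 2)).
assert (He : 0 <= e) by (unfold e; nra).
destruct (Rle_or_lt (norm2 x y) (Rr + 1)) as [Hn|Hn].
- generalize (momentum_bound 1 (Rr + 1) (ut T x y) (ux T x y) (uy T x y) x y Rlt_0_1 Hn).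
  intro Hm.
  assert (H1 : ut T x y ^ 2 + 1 ^ 2 * (ux T x y ^ 2 + uy T x y ^ 2) <= (1 + / km) * e).
  { assert (ux T x y ^ 2 + uy T x y ^ 2 <= / km * e).
    { apply Rmult_le_reg_l with km; trivial.
      rewrite <- Rmult_assoc, Rinv_r, Rmult_1_l by lra; unfold e; nra. }
    assert (ut T x y ^ 2 <= e) by (unfold e; nra); lra. }
  assert (H2 : chi x y * e <= e) by (generalize (chi_range x y); nra).
  assert (H3 : T * (chi x y * e) <= T * e) by now apply Rmult_le_compat_l.
  assert (H4 : (Rr + 1) / 1 * (ut T x y ^ 2 + 1 ^ 2 * (ux T x y ^ 2 + uy T x y ^ 2))
     <= (Rr + 1) * ((1 + / km) * e)).
  { unfold Rdiv; rewrite Rinv_1, Rmult_1_r; apply Rmult_le_compat_l; lra. }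
  assert (H5 : 0 <= rho / c * e) by (apply Rmult_le_pos; lra).
  unfold kap; lra.
- replace (chi x y) with 0.
  2: { unfold chi; rewrite Rmax_left; trivial; apply Rle_trans with (1 := Rmin_r _ _); lra. }
  rewrite Rmult_0_l, Rmult_0_r.
  destruct (Rle_or_lt (norm2 x y) (rho + c * T)) as [Hc1|Hc1].
  + generalize (momentum_bound c (rho + c * T) (ut T x y) (ux T x y) (uy T x y) x y Hc Hc1).
    rewrite <- (Hout x y) by lra; fold e; intro Hm.
    replace ((rho + c * T) / c) with (T + rho / c) in Hm by (field; lra).
    assert (0 <= (Rr + 1) * (1 + / km) * e) by (apply Rmult_le_pos; lra).
    unfold kap; lra.
  + destruct (finite_speed K u ut ux uy km c rho HK Hkm Hlow Hc Hout' Hu Hweak Hdata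
      T x y HT Hc1) as [_ [H1 [H2 H3]]].
    unfold e; rewrite H1, H2, H3; right; ring.
Qed.

Lemma local_energy_decay :
  exists C T0, 0 < C /\ 1 < T0 /\ forall T, T0 <= T ->
    RInt (fun x => RInt (fun y => ut T x y ^ 2 + K x y * (ux T x y ^ 2 + uy T x y ^ 2))
            (- sqrt (Rr ^ 2 - x ^ 2)) (sqrt (Rr ^ 2 - x ^ 2))) (- Rr) Rr
    <= C * / T * sqrt (ln T).
Proof.
c1 Hu.
assert (Hout' : forall x y, rho < norm2 x y -> K x y = c ^ 2) by (intros; apply Hout; lra).
assert (Hchi := cont2_chi).
assert (Hut0 : cont2 (ut 0)) by now apply cont3_slice.
set (m := rho + 1).
assert (Hzero : forall x y, m <= Rabs x \/ m <= Rabs y ->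
  u 0 x y = 0 /\ ut 0 x y = 0 /\ ux 0 x y = 0 /\ uy 0 x y = 0).
{ intros x y Hxy; apply Hdata; unfold m in Hxy.
  generalize (norm2_Rabs_l x y) (norm2_Rabs_r x y); destruct Hxy; lra. }
assert (HB : exists C1, 0 < C1 /\
  forall x y, Rabs (ut 0 x y) <= C1 * (2 * (/ (1 + (x ^ 2 + y ^ 2))) ^ 2)).
{ destruct (bounded_on_box (ut 0) m Hut0) as [B HB].
  assert (HB0 : 0 <= B) by (apply Rle_trans with (1 := Rabs_pos (ut 0 0 0)), HB; unfold m; lra).
  (* For |x| <= rho the weight 1/(1+|x|^2) is at least 1/(1+rho^2); [B + 1] makes the constant
     positive. *)
  exists ((B + 1) * (1 + rho ^ 2) ^ 2); split; [apply Rmult_lt_0_compat; nra|].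
  intros x y; generalize (one_plus_sq_pos x y); intro Hp.
  assert (Hip : 0 < / (1 + (x ^ 2 + y ^ 2))) by now apply Rinv_0_lt_compat.
  destruct (Rlt_or_le rho (norm2 x y)) as [Hn|Hn].
  - destruct (Hdata x y Hn) as [_ [-> _]]; rewrite Rabs_R0.
    repeat apply Rmult_le_pos; try nra.
  - assert (Hb : Rabs (ut 0 x y) <= B).
    { generalize (norm2_Rabs_l x y) (norm2_Rabs_r x y); intros.
      apply HB; apply Rabs_le_between; unfold m; lra. }
    assert (Hq : 1 <= (1 + rho ^ 2) * / (1 + (x ^ 2 + y ^ 2))).
    { apply Rmult_le_reg_r with (1 + (x ^ 2 + y ^ 2)); trivial.
      rewrite Rmult_assoc, Rinv_l by lra.
      generalize (norm2_sqr x y) (norm2_nonneg x y); nra. }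
    replace ((B + 1) * (1 + rho ^ 2) ^ 2 * (2 * (/ (1 + (x ^ 2 + y ^ 2))) ^ 2)) with
      (2 * (B + 1) * ((1 + rho ^ 2) * / (1 + (x ^ 2 + y ^ 2))) ^ 2) by ring.
    apply Rle_trans with (2 * (B + 1) * 1); [lra|].
    apply Rmult_le_compat_l; nra. }
destruct HB as [C1 [HC1 Hu1]].
(* The data are integrated over a fixed square, so that the final constant does not depend on T,
   whereas [M] grows with T. *)
set (A1 := I2 m (fun x y => ut 0 x y ^ 2 + K x y * (ux 0 x y ^ 2 + uy 0 x y ^ 2))).
set (A2 := I2 m (fun x y => u 0 x y ^ 2)).
set (A3 := I2 m (fun x y => Rabs (ut 0 x y))).
set (A4 := I2 m (fun x y => ut 0 x y * (x * ux 0 x y + y * uy 0 x y))).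
set (A5 := I2 m (fun x y => ut 0 x y * u 0 x y)).
assert (Hm : 0 < m) by (unfold m; lra).
assert (HA1 : 0 <= A1).
{ apply I2_ge_0; [lra | cont |]; intros x y _ _; generalize (Hlow x y); nra. }
assert (HA2 : 0 <= A2) by (apply I2_ge_0; [lra | cont |]; intros; nra).
assert (HA3 : 0 <= A3) by (apply I2_ge_0; [lra | cont |]; intros; apply Rabs_pos).
assert (Hrc : 0 < rho / c) by (apply Rdiv_lt_0_compat; lra).
assert (Hkmi : 0 < / km) by now apply Rinv_0_lt_compat.
assert (Hkap : 0 < kap) by (unfold kap; nra).
(* Chosen so that 2 M + 1 = 4 rho + 4 c T + 5 is at most T D. *)
set (D := 4 * rho + 4 * c + 5).
assert (HD : 0 < ln D) by (rewrite <- ln_1; apply ln_increasing; unfold D; lra).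
set (k8 := 8 * C1 ^ 2 / km).
assert (Hk8 : 0 < k8) by (unfold k8; apply Rdiv_lt_0_compat; [nra | lra]).
set (C0 := 2 * Rabs A4 + Rabs A5 + kap * A1 + / 2 * (A1 + (A2 + 2 * A3 + k8 * (1 + ln D)))).
assert (HC0 : 0 <= C0).
{ unfold C0; generalize (Rabs_pos A4) (Rabs_pos A5); intros.
  assert (0 <= kap * A1) by nra; assert (0 <= k8 * (1 + ln D)) by nra; lra. }
(* T >= 3 > e gives ln T >= 1, and T >= Rr / c puts the disc inside the square; the added 1 makes
   the constant positive. *)
exists (C0 + 1), (3 + Rr / c).
assert (HRc : 0 < Rr / c) by (apply Rdiv_lt_0_compat; lra).
split; [lra | split; [lra|]]; intros T HT.
assert (HT0 : 0 < T) by lra.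
assert (HlnT : 1 <= ln T).
{ rewrite <- (ln_exp 1); destruct (Req_dec (exp 1) T) as [->|]; [lra|].
  left; apply ln_increasing; [apply exp_pos|]; generalize exp_le_3; lra. }
set (k := sqrt (ln T)).
assert (Hk2 : k ^ 2 = ln T) by (apply pow2_sqrt; lra).
assert (Hk : 1 <= k) by (unfold k; rewrite <- sqrt_1; apply sqrt_le_1; lra).
set (M0 := rho + c * T); set (M := 2 * M0 + 2).
assert (HcT : 0 < c * T) by (apply Rmult_lt_0_compat; trivial).
assert (HM0 : 0 < M0) by (unfold M0; lra).
assert (HmM : 0 <= m <= M) by (unfold m, M, M0; lra).
assert (HRM : 0 < Rr <= M).
{ split; [lra|]; assert (Rr <= c * T); [|unfold M, M0; lra].
  replace Rr with (c * (Rr / c)) by (field; lra).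
  apply Rmult_le_compat_l; lra. }
assert (Hsupp : forall t x y, 0 <= t <= T -> M0 < norm2 x y ->
  u t x y = 0 /\ ut t x y = 0 /\ ux t x y = 0 /\ uy t x y = 0).
{ intros t x y Ht Hn.
  apply (finite_speed K u ut ux uy km c rho HK Hkm Hlow Hc Hout' Hu Hweak Hdata t x y);
    [lra|].
  apply Rle_lt_trans with (2 := Hn); unfold M0; apply Rplus_le_compat_l, Rmult_le_compat_l; lra. }
assert (Hsupp' : forall t x y, 0 <= t <= T -> M <= Rabs x \/ M <= Rabs y -> u t x y = 0).
{ intros t x y Ht Hxy; apply (Hsupp t x y Ht); unfold M in Hxy.
  generalize (norm2_Rabs_l x y) (norm2_Rabs_r x y); destruct Hxy; lra. }
assert (HMor := morawetz_inequality K Kx Ky u ut ux uy T M0 HK HKx HKy HdKx HdKy Hrad Hu Hweak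
  HT0 HM0 Hsupp).
assert (Hcons := energy_conserved K u ut ux uy T M0 HK Hu Hweak HT0 HM0 Hsupp T ltac:(lra)).
assert (HL2 := l2_bound K u ut ux uy T M km C1 HK Hkm Hlow Hu Hweak HT0 ltac:(lra) Hsupp' HC1 Hu1).
cbv beta zeta in HMor, Hcons; fold M in HMor, Hcons.
assert (HE0 : I2 M (fun x y => ut 0 x y ^ 2 + K x y * (ux 0 x y ^ 2 + uy 0 x y ^ 2)) = A1).
{ apply I2_enlarge; [trivial | cont |].
  intros x y Hxy; destruct (Hzero x y Hxy) as [_ [-> [-> ->]]]; ring. }
rewrite HE0 in HMor, Hcons.
rewrite (I2_enlarge m M (fun x y => ut 0 x y * (x * ux 0 x y + y * uy 0 x y))) in HMor; trivial.
2: cont.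
2: { intros x y Hxy; destruct (Hzero x y Hxy) as [_ [-> _]]; ring. }
rewrite (I2_enlarge m M (fun x y => ut 0 x y * u 0 x y)) in HMor; trivial.
2: cont.
2: { intros x y Hxy; destruct (Hzero x y Hxy) as [-> _]; ring. }
rewrite (I2_enlarge m M (fun x y => u 0 x y ^ 2)) in HL2; trivial.
2: cont.
2: { intros x y Hxy; destruct (Hzero x y Hxy) as [-> _]; ring. }
rewrite (I2_enlarge m M (fun x y => Rabs (ut 0 x y))) in HL2; trivial.
2: cont.
2: { intros x y Hxy; destruct (Hzero x y Hxy) as [_ [-> _]]; apply Rabs_R0. }
fold A4 A5 in HMor; fold A2 A3 k8 in HL2.
assert (HlnM : ln (2 * M + 1) <= (1 + ln D) * ln T).
{ apply Rle_trans with (ln T + ln D).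
  - rewrite <- ln_mult by (unfold D; lra).
    assert (HMD : 2 * M + 1 <= T * D) by (unfold M, M0, D; nra).
    destruct HMD as [HMD| ->]; [|lra].
    left; apply ln_increasing; trivial; unfold M; lra.
  - assert (ln D * 1 <= ln D * ln T) by (apply Rmult_le_compat_l; lra); lra. }
set (N := I2 M (fun x y => ut T x y * u T x y)) in *.
set (P := I2 M (fun x y => ut T x y * (x * ux T x y + y * uy T x y))) in *.
set (U := I2 M (fun x y => u T x y ^ 2)) in *.
(* Young's inequality with weight k = sqrt(ln T): since U is O(k^2), both terms are O(k). *)
assert (HN : - N <= / 2 * (k * A1 + / k * U)).
{ unfold N, U; rewrite <- Hcons.
  assert (0 < / k) by (apply Rinv_0_lt_compat; lra).
  replace (- I2 M (fun x y => ut T x y * u T x y)) with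
    ((-1) * I2 M (fun x y => ut T x y * u T x y)) by ring.
  rewrite <- !I2_scal, <- I2_plus, <- I2_scal by cont.
  apply I2_le; [lra | cont | cont |]; intros x y _ _.
  assert (0 <= K x y * (ux T x y ^ 2 + uy T x y ^ 2)) by (generalize (Hlow x y); nra).
  assert (Hkk : k * / k = 1) by (apply Rinv_r; lra).
  assert (0 <= / k * (k * ut T x y + u T x y) ^ 2)
    by (apply Rmult_le_pos; [lra | apply pow2_ge_0]).
  replace (/ k * (k * ut T x y + u T x y) ^ 2) with
    ((k * / k) * (k * ut T x y ^ 2) + 2 * (k * / k) * (ut T x y * u T x y) + / k * u T x y ^ 2)
    in * by ring.
  rewrite Hkk in *.
  assert (0 <= k * (K x y * (ux T x y ^ 2 + uy T x y ^ 2))) by (apply Rmult_le_pos; lra).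
  lra. }
assert (HU : / k * U <= k * (A2 + 2 * A3 + k8 * (1 + ln D))).
{ apply Rmult_le_reg_l with k; [lra|].
  rewrite <- !Rmult_assoc, Rinv_r, Rmult_1_l by lra.
  replace (k * k) with (ln T) by (rewrite <- Hk2; ring).
  assert (k8 * ln (2 * M + 1) <= k8 * ((1 + ln D) * ln T))
    by (apply Rmult_le_compat_l; lra).
  assert ((A2 + 2 * A3) * 1 <= (A2 + 2 * A3) * ln T) by (apply Rmult_le_compat_l; lra).
  lra. }
set (e := fun x y => ut T x y ^ 2 + K x y * (ux T x y ^ 2 + uy T x y ^ 2)).
assert (He : cont2 e) by (unfold e; cont).
assert (Hloc : T * I2 M (fun x y => chi x y * e x y) <= k * C0).
{ apply Rle_trans with ((T + kap) * A1 + 2 * P).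
  - unfold P; rewrite <- Hcons, <- !I2_scal, <- I2_plus by (unfold e; cont).
    apply I2_le; [lra | cont | cont |]; intros x y _ _.
    apply cutoff_energy_bound; lra.
  - assert (H1k : 1 * (2 * Rabs A4 + Rabs A5 + kap * A1) <= k * (2 * Rabs A4 + Rabs A5 + kap * A1)).
    { apply Rmult_le_compat_r; trivial.
      generalize (Rabs_pos A4) (Rabs_pos A5); assert (0 <= kap * A1) by nra; lra. }
    unfold C0; generalize (Rle_abs A4) (Rle_abs A5); lra. }
apply Rle_trans with (I2 M (fun x y => chi x y * e x y)).
- apply RInt_disc_le; trivial; try cont.
  + intros x y; apply Rmult_le_pos; [apply chi_range|].
    unfold e; generalize (Hlow x y); nra.
  + intros x y Hn; replace (chi x y) with 1; [symmetry; apply Rmult_1_l|].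
    unfold chi; rewrite Rmin_left, Rmax_right by lra; trivial.
- apply Rmult_le_reg_l with T; trivial.
  replace (T * ((C0 + 1) * / T * k)) with (k * (C0 + 1)) by (field; lra).
  lra.
Qed.

End Decay.

Theorem theorem1p1
  (K : R -> R -> R) (km k0 r0 L : R) (u0 u1 : R -> R -> R)
  (u : R -> R -> R -> R) (Rr : R)
  (HK : BC1 K)
  (Hkm : 0 < km) (Hlow : forall x y : R, km <= K x y)
  (Hrad : forall x y : R, x * pd1 K x y + y * pd2 K x y <= 0)
  (Hr0 : 0 < r0) (Hk0 : km <= k0)
  (Hout : forall x y : R, norm2 x y > r0 -> K x y = k0)
  (HL : 0 < L)
  (Hu0 : smooth2 u0) (Hu1 : smooth2 u1)
  (Hs0 : supp_in_ball u0 L) (Hs1 : supp_in_ball u1 L)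
  (Hureg : C1_3 u) (Hsol : weak_wave_sol K u)
  (Hinit0 : forall x y : R, u 0 x y = u0 x y)
  (Hinit1 : forall x y : R, dt u 0 x y = u1 x y)
  (HR : r0 < Rr) :
  exists C T : R, 0 < C /\ 1 < T /\
    forall t : R, T <= t -> local_energy K u Rr t <= C * / t * sqrt (ln t).
Proof.
destruct HK as [HKc [_ [HKd [HKx [HKy _]]]]].
assert (Hu := C1_3_is_C1 u Hureg).
(* Finite speed needs a radius beyond which the data vanish and [K] is constant. *)
set (rho := Rmax L r0).
assert (Hrho : 0 < r0 <= rho) by (split; [trivial | apply Rmax_r]).
assert (HLrho : L <= rho) by apply Rmax_l.
assert (Hk0p : 0 < k0) by lra.
assert (Hc : 0 < sqrt k0) by now apply sqrt_lt_R0.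
assert (Hc2 : sqrt k0 ^ 2 = k0) by (apply pow2_sqrt; lra).
assert (Hweak : weak_law (fun t x y => - dt u t x y)
  (fun t x y => K x y * dx1 u t x y) (fun t x y => K x y * dx2 u t x y)).
{ intros eta et ex ey a b M He Ha Hab HM Hsupp.
  rewrite <- (Hsol eta a b M Ha Hab HM (is_C1_C1_3 _ _ _ _ He) Hsupp).
  rewrite !box_int_I2; apply RInt_ext_R; intros t _.
  apply I2_ext; [lra|]; intros x y _ _.
  rewrite (is_C1_dt _ _ _ _ t x y He), (is_C1_dx1 _ _ _ _ t x y He),
    (is_C1_dx2 _ _ _ _ t x y He); ring. }
assert (Hu00 : forall x y, rho < norm2 x y -> u 0 x y = 0).
{ intros; rewrite Hinit0; apply Hs0; lra. }
assert (Hdata : forall x y, rho < norm2 x y ->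
  u 0 x y = 0 /\ dt u 0 x y = 0 /\ dx1 u 0 x y = 0 /\ dx2 u 0 x y = 0).
{ intros x y Hn; split; [auto|]; split; [rewrite Hinit1; apply Hs1; lra|].
  assert (Hn0 : forall z, norm2 z 0 = Rabs z /\ norm2 0 z = Rabs z).
  { intro z; rewrite <- sqrt_Rsqr_abs; unfold norm2, Rsqr; split; f_equal; ring. }
  split.
  (* Points closer than [norm2 x y - rho] are still outside the ball by the triangle inequality, so
     [u 0] is locally zero. *)
  - apply (is_derive_zero_loc (fun s => u 0 s y) x _ (norm2 x y - rho)); [lra | apply (C1_x Hu)|].
    intros s Hs; apply Hu00; generalize (norm2_triangle s y x y).
    replace (y - y) with 0 by ring; rewrite (proj1 (Hn0 _)).
    assert (Rabs (s - x) < norm2 x y - rho) by (apply Rabs_def1; lra); lra.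
  - apply (is_derive_zero_loc (fun s => u 0 x s) y _ (norm2 x y - rho)); [lra | apply (C1_y Hu)|].
    intros s Hs; apply Hu00; generalize (norm2_triangle x s x y).
    replace (x - x) with 0 by ring; rewrite (proj2 (Hn0 _)).
    assert (Rabs (s - y) < norm2 x y - rho) by (apply Rabs_def1; lra); lra. }
destruct (local_energy_decay K (pd1 K) (pd2 K) u (dt u) (dx1 u) (dx2 u) km (sqrt k0) r0 rho Rr)
  as [C [T [HC [HT H]]]]; trivial.
- intros x y; exact (Derive_correct _ _ (proj1 (HKd x y))).
- intros x y; exact (Derive_correct _ _ (proj2 (HKd x y))).
- intros x y Hn; rewrite Hc2; now apply Hout.
- exists C, T; split; [trivial | split; [trivial|]]; intros t Ht.
  specialize (H t Ht).
  (* The bound [H] is for the integral without the factor 1/2; nonnegativity of the right-hand side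
     lets the factor be inserted. *)
  assert (0 <= C * / t * sqrt (ln t)).
  { apply Rmult_le_pos; [|apply sqrt_pos].
    apply Rmult_le_pos; [lra | left; apply Rinv_0_lt_compat; lra]. }
  unfold local_energy; lra.
Qed.
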